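(* Every $H$-algebra is a $V$-algebra, and therefore also a $P$-algebra, in a canonical way. Concretely, if $(A,a)$ is an $H$-algebra, then $(A,\,a\circ\mathrm{supp}_A)$ is a $V$-algebra, and therefore $(A,\,a\circ\mathrm{supp}_A\circ\iota_A)$ is a $P$-algebra.
   Context: $\mathsf{Top}$ is the category of all topological spaces and continuous maps; $\mathcal{O}(X)$ is the set of open subsets of $X$. For a monad $(T,\eta,\mu)$ on $\mathsf{Top}$, a $T$-algebra is a (Eilenberg–Moore) algebra: a space $A$ with a continuous map $a:TA\to A$ such that $a\circ\eta_A=\mathrm{id}_A$ and $a\circ T(a)=a\circ\mu_A$. The monad $H$. $HX$ is the set of all closed subsets of $X$ (including $\varnothing$) with the topology generated by the sets $\{C\in HX: C\cap U\neq\varnothing\}$ for $U\in\mathcal{O}(X)$. On morphisms $f_\sharp C=\mathrm{cl}(f(C))$; unit $\sigma(x)=\mathrm{cl}(\{x\})$; multiplication $\mathcal{U}(\mathcal{C})=\mathrm{cl}(\bigcup_{C\in\mathcal{C}}C)$. The monad $V$. $[0,\infty]$ carries the upper topology (open sets $\varnothing$, $[0,\infty]$ and $(r,\infty]$), and $[0,\infty]^X$ is the set of continuous (i.e. lower semicontinuous) maps $X\to[0,\infty]$, with pointwise order and algebra, $0\cdot\infty=0$. A continuous valuation on $X$ is a map $\nu:\mathcal{O}(X)\to[0,\infty]$ with $\nu(\varnothing)=0$, $\nu(U\cup W)+\nu(U\cap W)=\nu(U)+\nu(W)$, and $\nu(\bigcup_\lambda U_\lambda)=\sup_\lambda\nu(U_\lambda)$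 for every directed net of open sets. For simple lower semicontinuous $f=\sum_ir_i1_{U_i}$ ($U_i$ open, $r_i\in(0,\infty]$, finite sum) put $\int f\,d\nu=\sum_ir_i\nu(U_i)$, and for $g\in[0,\infty]^X$ put $\langle\nu,g\rangle=\sup\{\int f\,d\nu: f\text{ simple lower semicontinuous}, f\le g\}$. $VX$ is the set of continuous valuations with the weakest topology making $\nu\mapsto\langle\nu,g\rangle$ continuous for every $g\in[0,\infty]^X$. On morphisms $(f_*\nu)(U)=\nu(f^{-1}(U))$; unit $\delta(x)(U)=1_U(x)$; multiplication $\mathcal{E}$ determined by $\langle\mathcal{E}\xi,g\rangle=\langle\xi,\ \rho\mapsto\langle\rho,g\rangle\rangle$ for $\xi\in VVX$, $g\in[0,\infty]^X$. The monad $P$. A Borel measure $m$ is $\tau$-smooth if $m(\bigcup_\lambda U_\lambda)=\sup_\lambda m(U_\lambda)$ for every directed net of open sets. $PX$ is the set of $\tau$-smooth Borel probability measures on $X$ with the weakest topology making $p\mapsto\int f\,dp$ continuous for all lower semicontinuous $f:X\to[0,\infty]$. On morphisms it is pushforward of measures; the unit is the Dirac measure; the multiplication is $(E\mu)(A)=\int_{PX}p(A)\,d\mu(p)$ for Borel $A$. $\iota_X:PX\hookrightarrow VX$ restricts a measure to open sets; $\iota$ is a morphism of monads. Support. For $\nu\in VX$, $\mathrm{supp}_X(\nu)\in HX$ is the closed set characterized by: for every open $U\subseteq X$, $\mathrm{supp}_X(\nu)\cap U\neq\varnothing$ iff $\nu(U)>0$. *)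

(* Defs.v *)
From HB Require Import structures.
From mathcomp Require Import all_boot all_order all_algebra.
From mathcomp Require Import all_classical all_reals all_analysis.
From mathcomp Require Import measurable_realfun.
From mathcomp Require Import lra ring zify.

Set Implicit Arguments.
Unset Strict Implicit.
Unset Printing Implicit Defensive.

Import Order.TTheory GRing.Theory Num.Theory.
Import numFieldNormedType.Exports.

Local Open Scope classical_set_scope.

Record monad := Monad {
  mobj :> topologicalType -> topologicalType;
  mmap : forall X Y : topologicalType,
    continuousType X Y -> continuousType (mobj X) (mobj Y);
  munit : forall X : topologicalType, continuousType X (mobj X);
  mmult : forall X : topologicalType,
    continuousType (mobj (mobj X)) (mobj X);
  mmap_id : forall X (t : mobj X), mmap idfun t = t;
  mmap_comp : forall (X Y Z : topologicalType) (f : continuousType X Y) (g : continuousType Y Z)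
    (t : mobj X), mmap (g \o f) t = mmap g (mmap f t);
  munit_nat : forall (X Y : topologicalType) (f : continuousType X Y) x,
    mmap f (munit X x) = munit Y (f x);
  mmult_nat : forall (X Y : topologicalType) (f : continuousType X Y) (t : mobj (mobj X)),
    mmap f (mmult X t) = mmult Y (mmap (mmap f) t);
  mmult_unit : forall X (t : mobj X), mmult X (munit (mobj X) t) = t;
  mmult_map_unit : forall X (t : mobj X), mmult X (mmap (munit X) t) = t;
  mmult_assoc : forall X (t : mobj (mobj (mobj X))),
    mmult X (mmult (mobj X) t) = mmult X (mmap (mmult X) t) }.

Arguments mmap T {X Y} : rename.
Arguments munit T X : rename.
Arguments mmult T X : rename.

Definition is_algebra (T : monad) (A : topologicalType) (a : T A -> A) :=
  exists ca : continuous a,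
    (forall x : A, a (munit T A x) = x) /\
    (forall t : T (T A), a (mmap T (mkcts ca) t) = a (mmult T A t)).

Arguments is_algebra T {A}.

(* T with the coarsest topology in which the members of S are open *)
Definition gen_topology (T : Type) (S : set (set T)) : Type := T.

Section gen_topology.
Context (T : choiceType) (S : set (set T)).

HB.instance Definition _ := Choice.on (gen_topology S).
HB.instance Definition _ := isSubBaseTopological.Build (gen_topology S) S id.

Lemma gen_topology_open (U : set T) : S U -> open (U : set (gen_topology S)).
Proof.
move=> SU; exists [set U]; last by rewrite bigcup_set1.
by move=> _ ->; exact: finI_from1.
Qed.

Lemma gen_topology_continuous (Y : topologicalType) (f : Y -> gen_topology S) :
  (forall U, S U -> open (f @^-1` U)) -> continuous f.
Proof.
move=> fS; apply/continuousP => _ [D' D'S <-].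
rewrite preimage_bigcup; apply: bigcup_open => A /D'S [F FS <-].
rewrite preimage_bigcap bigcap_fset big_seq.
apply: big_ind => [||i iF]; [exact: openT|exact: openI|].
by apply: fS; have := FS _ iF; rewrite inE.
Qed.

End gen_topology.

Section hyperspace.
Context (X : topologicalType).

(* The empty set is included. *)
Record closed_set := ClosedSet {
  cset :> set X;
  cset_closed : closed cset }.

Lemma closed_set_eq (C D : closed_set) : cset C = cset D -> C = D.
Proof.
by case: C D => C cC [D cD] /= CD; subst D; congr ClosedSet; exact: Prop_irrelevance.
Qed.

Definition cl (A : set X) : closed_set := ClosedSet (@closed_closure X A).

Definition hit (U : set X) : set closed_set := [set C | C `&` U !=set0].

HB.instance Definition _ := gen_eqMixin closed_set.
HB.instance Definition _ := gen_choiceMixin closed_set.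
HB.instance Definition _ := Topological.copy closed_set
  (gen_topology [set hit U | U in open]).

Lemma hit_open (U : set X) : open U -> open (hit U).
Proof. by move=> oU; apply: gen_topology_open; exists U. Qed.

Lemma hit_cl (A U : set X) : open U -> hit U (cl A) <-> A `&` U !=set0.
Proof.
move=> oU; split=> [[x [clAx Ux]]|[x [Ax Ux]]].
  exact: (clAx U (open_nbhs_nbhs (conj oU Ux))).
by exists x; split => //; exact: subset_closure.
Qed.

Lemma hit_ext (C D : closed_set) :
  (forall U, open U -> hit U C <-> hit U D) -> C = D.
Proof.
move=> CD; apply: closed_set_eq.
have sub (E F : closed_set) :
    (forall U, open U -> hit U E -> hit U F) -> E `<=` F.
  move=> EF x Ex; apply: contrapT => nFx.
  have oF : open (~` F) by rewrite openC; exact: cset_closed.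
  by have [y []] := EF _ oF (ex_intro _ x (conj Ex nFx)).
by apply/seteqP; split; apply: sub => U oU; rewrite CD.
Qed.

End hyperspace.

Section hyperspace_monad.

Lemma hit_continuous (X Y : topologicalType) (f : Y -> closed_set X) :
  (forall U, open U -> open (f @^-1` hit U)) -> continuous f.
Proof.
move=> fU; apply: (@gen_topology_continuous (closed_set X)) => _ [U oU <-].
exact: fU.
Qed.

Section map.
Context (X Y : topologicalType) (f : continuousType X Y).

Definition hyper_map (C : closed_set X) : closed_set Y := cl (f @` C).

Lemma hit_map (U : set Y) C : open U -> hit U (hyper_map C) <-> hit (f @^-1` U) C.
Proof.
move=> oU; rewrite hit_cl//; split=> [[_ [[x Cx <-] Ux]]|[x [Cx Ux]]].
  by exists x.
by exists (f x); split => //; exists x.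
Qed.

Let cf_open (U : set Y) : open U -> open (f @^-1` U).
Proof. by move=> oU; move/continuousP : (@cts_fun _ _ f); apply. Qed.

Lemma hyper_map_continuous : continuous hyper_map.
Proof.
apply: hit_continuous => U oU.
rewrite (_ : _ @^-1` _ = hit (f @^-1` U)).
  exact/hit_open/cf_open.
by apply/seteqP; split => C /hit_map; exact.
Qed.

HB.instance Definition _ := isContinuous.Build _ _ hyper_map hyper_map_continuous.
End map.

Section unit_mult.
Context (X : topologicalType).

Definition hyper_unit (x : X) : closed_set X := cl [set x].

Definition hyper_mult (CC : closed_set (closed_set X)) : closed_set X :=
  cl (\bigcup_(C in CC) C).

Lemma hit_unit (U : set X) x : open U -> hit U (hyper_unit x) <-> U x.
Proof.
move=> oU; rewrite hit_cl//; split=> [[y [-> //]]|Ux].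
by exists x.
Qed.

Lemma hit_mult (U : set X) CC : open U ->
  hit U (hyper_mult CC) <-> hit (hit U) CC.
Proof.
move=> oU; rewrite hit_cl//; split=> [[x [[C CCC Cx] Ux]]|[C [CCC [x [Cx Ux]]]]].
  by exists C; split => //; exists x.
by exists x; split => //; exists C.
Qed.

Lemma hyper_unit_continuous : continuous hyper_unit.
Proof.
apply: hit_continuous => U oU.
rewrite (_ : _ @^-1` _ = U)//.
by apply/seteqP; split => C /hit_unit; exact.
Qed.

Lemma hyper_mult_continuous : continuous hyper_mult.
Proof.
apply: hit_continuous => U oU.
rewrite (_ : _ @^-1` _ = hit (hit U)); first exact/hit_open/hit_open.
by apply/seteqP; split => C /hit_mult; exact.
Qed.

HB.instance Definition _ := isContinuous.Build _ _ hyper_unit hyper_unit_continuous.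
HB.instance Definition _ := isContinuous.Build _ _ hyper_mult hyper_mult_continuous.
End unit_mult.

Lemma cts_open (X Y : topologicalType) (f : continuousType X Y) (U : set Y) :
  open U -> open (f @^-1` U).
Proof. by move=> oU; move/continuousP : (@cts_fun _ _ f); apply. Qed.

Definition monadH : monad.
Proof.
apply: (@Monad (fun X => closed_set X) (fun X Y f => hyper_map f)
  (fun X => @hyper_unit X) (fun X => @hyper_mult X)).
- by move=> X t; apply: hit_ext => U oU; rewrite hit_map.
- move=> X Y Z f g t; apply: hit_ext => U oU.
  by rewrite !hit_map//; exact: cts_open.
- move=> X Y f x; apply: hit_ext => U oU.
  by rewrite hit_map// !hit_unit//; exact: cts_open.
- move=> X Y f t; apply: hit_ext => U oU.
  have ofU := cts_open f oU.
  have ohU := hit_open oU.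
  rewrite hit_map// !hit_mult// hit_map//.
  have -> // : hyper_map f @^-1` hit U = hit (f @^-1` U).
  by apply/seteqP; split => C /hit_map; exact.
- move=> X t; apply: hit_ext => U oU.
  have ohU := hit_open oU.
  by rewrite hit_mult// hit_unit.
- move=> X t; apply: hit_ext => U oU.
  have ohU := hit_open oU.
  rewrite hit_mult// hit_map//.
  have -> // : @hyper_unit X @^-1` hit U = U.
  by apply/seteqP; split => C /hit_unit; exact.
- move=> X t; apply: hit_ext => U oU.
  have ohU := hit_open oU.
  have ohhU := hit_open ohU.
  rewrite !hit_mult// hit_map//.
  have -> // : @hyper_mult X @^-1` hit U = hit (hit U).
  by apply/seteqP; split => C /hit_mult; exact.
Defined.

End hyperspace_monad.

Local Open Scope ring_scope.
Local Open Scope ereal_scope.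

Record open_set (X : topologicalType) := OpenSet {
  oset :> set X;
  oset_open : open oset }.

Lemma open_set_eq (X : topologicalType) (U W : open_set X) :
  oset U = oset W -> U = W.
Proof.
by case: U W => U oU [W oW] /= UW; subst W; congr OpenSet; exact: Prop_irrelevance.
Qed.

(* Directed nets of sets are nonempty families directed by inclusion. *)
Definition directed (T I : Type) (U : I -> set T) :=
  $| I | /\ forall i j, exists k, U i `|` U j `<=` U k.

Definition bigcup_open_set (X : topologicalType) (I : Type)
  (U : I -> open_set X) : open_set X :=
  OpenSet (bigcup_open (fun i (_ : [set: I] i) => oset_open (U i))).

Section valuation.
Context (R : realType) (X : topologicalType).

Record valuation := Valuation {
  vfun :> open_set X -> \bar R;
  v_ge0 : forall U, 0 <= vfun U;
  v_set0 : vfun (OpenSet open0) = 0;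
  v_modular : forall U W : open_set X,
    vfun (OpenSet (openU (oset_open U) (oset_open W))) +
    vfun (OpenSet (openI (oset_open U) (oset_open W))) = vfun U + vfun W;
  v_directed : forall (I : Type) (U : I -> open_set X),
    directed U -> vfun (bigcup_open_set U) = ereal_sup (range (vfun \o U)) }.

Lemma valuation_eq (nu mu : valuation) : (forall U, nu U = mu U) -> nu = mu.
Proof.
case: nu mu => [f ? ? ? ?] [g ? ? ? ?] /= /funext fg; subst g.
by congr Valuation; exact: Prop_irrelevance.
Qed.

(* The continuous maps from X to [0, +oo] with the upper topology. *)
Definition lsc_ge0 (g : X -> \bar R) :=
  (forall x, 0 <= g x) /\ lower_semicontinuous g.

(* <nu, g>: the supremum, over the simple functions \sum_i r_i 1_(U_i) <= g with
   r_i in ]0, +oo], of \sum_i r_i nu(U_i). *)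
Definition vint (nu : valuation) (g : X -> \bar R) : \bar R :=
  ereal_sup [set z | exists (n : nat) (r : 'I_n -> \bar R)
    (U : 'I_n -> open_set X),
    [/\ forall i, 0 < r i,
        forall x, \sum_(i < n) r i * (\1_(U i) x)%:E <= g x &
        z = \sum_(i < n) r i * nu (U i)]].

(* The generators are the preimages of the open sets ]r, +oo] under the maps
   nu |-> <nu, g>. *)
HB.instance Definition _ := gen_eqMixin valuation.
HB.instance Definition _ := gen_choiceMixin valuation.
HB.instance Definition _ := Topological.copy valuation
  (gen_topology [set A : set valuation | exists2 g, lsc_ge0 g &
    exists r : R, A = [set nu | r%:E < vint nu g]]).

End valuation.

Section ereal_approx.
Context (R : realType).
Implicit Types (v c J r : \bar R).

Lemma le_mule_approx v c J r : 0 <= v -> 0 <= c -> 0 < r ->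
  (forall q : R, (0 <= q)%R -> q%:E < r -> q%:E * v + c <= J) -> r * v + c <= J.
Proof.
move=> v0 c0 r0 H0.
have cJ : c <= J by have := H0 0%R (lexx _) r0; rewrite mul0e add0e.
have [q q0 qr] : exists2 q : R, (0 < q)%R & q%:E < r.
  case: r r0 H0 => [r||]//; rewrite ?lte_fin => r0 _.
    by exists (r / 2)%R; rewrite ?lte_fin ?divr_gt0// ltr_pdivrMr// ltr_pMr// ltr1n.
  by exists 1%R => //; rewrite ltry.
case: v v0 H0 => [v||]// v0 H0; last first.
  have := H0 q (ltW q0) qr.
  rewrite mulry gtr0_sg// mul1e addye ?leye_eq; last by case: c c0 {cJ H0} => //.
  by move=> /eqP ->; exact: leey.
rewrite lee_fin in v0.
have [v00|vN0] := eqVneq v 0%R.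
  by subst v; rewrite mule0 add0e.
have {vN0}v0 : (0 < v)%R by rewrite lt_neqAle eq_sym vN0.
case: c c0 cJ H0 => [c||]// c0 cJ H0; last first.
  by move: cJ; rewrite leye_eq => /eqP ->; exact: leey.
case: J cJ H0 => [J||]// cJ H0; last exact: leey.
rewrite lee_fin in cJ.
rewrite leNgt; apply/negP => abs.
have [p pr Jp] : exists2 p : R, ((J - c) / v < p)%R & p%:E < r.
  case: r r0 abs {qr H0} => [r||]// r0; last first.
    by exists ((J - c) / v + 1)%R; rewrite ?ltrDl// ltry.
  rewrite -EFinM -EFinD lte_fin -ltrBlDr -ltr_pdivrMr// => abs.
  exists (((J - c) / v + r) / 2)%R; rewrite ?lte_fin; lra.
have p0 : (0 <= p)%R.
  by apply: ltW; apply: le_lt_trans pr; rewrite divr_ge0 ?subr_ge0// ltW.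
have := H0 p p0 Jp; rewrite -EFinM -EFinD lee_fin leNgt => /negP; apply.
by rewrite -ltrBlDr -ltr_pdivrMr.
Qed.

Lemma le_sum_approx n (v r : 'I_n -> \bar R) c J : (forall i, 0 <= v i) ->
  0 <= c -> (forall i, 0 < r i) ->
  (forall q : 'I_n -> R, (forall i, (0 <= q i)%R /\ (q i)%:E < r i) ->
    \sum_(i < n) (q i)%:E * v i + c <= J) -> \sum_(i < n) r i * v i + c <= J.
Proof.
elim: n v r c => [|n IH] v r c v0 c0 r0 H0.
  by have := H0 (fun=> 0%R); rewrite !big_ord0; apply; case.
rewrite big_ord_recl -addeA; apply: le_mule_approx => //.
  by rewrite adde_ge0// sume_ge0// => i _; rewrite mule_ge0// ltW.
move=> q0 q00 q0r; rewrite addeCA; apply: IH => //.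
  by rewrite adde_ge0// mule_ge0.
move=> q qr.
have := H0 (fun i => oapp q q0 (unlift ord0 i)).
rewrite big_ord_recl unlift_none/=.
under eq_bigr do rewrite liftK/=.
rewrite addeCA addeA; apply => i.
by case: unliftP => [j ->|->]/=; [exact: qr|].
Qed.

Lemma le_sum_dyadic n (v r : 'I_n -> \bar R) J : (forall i, 0 <= v i) ->
  (forall i, 0 < r i) ->
  (forall N (a : 'I_n -> nat),
    (forall i, ((a i + 2)%:R * 2 ^- N)%:E <= r i) ->
    (\sum_i a i <= 4 ^ N)%N ->
    (2 ^- N)%:E * (\sum_(i < n) (a i)%:R%:E * v i) <= J) ->
  \sum_(i < n) r i * v i <= J.
Proof.
move=> v0 r0 H0; rewrite -[leLHS]adde0; apply: le_sum_approx => // q qr.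
rewrite adde0.
have /choice[d dP] : forall i, exists d : R, (0 < d)%R /\ (q i + d)%:E <= r i.
  move=> i; have [q0 qri] := qr i; case: (r i) qri => [s||]//.
    rewrite lte_fin => qs; exists (s - q i)%R; split; first by rewrite subr_gt0.
    by rewrite lee_fin addrC subrK.
  by exists 1%R; rewrite leey.
pose K : R := (\sum_i (3 / d i) + \sum_i q i + n%:R)%R.
pose N := (Num.truncn K).+1.
have d0 i : (0 < d i)%R by case: (dP i).
have q0 i : (0 <= q i)%R by case: (qr i).
have s0 : (0 <= \sum_i (3 / d i))%R by apply: sumr_ge0 => i _; rewrite divr_ge0// ltW.
have s1 : (0 <= \sum_i q i)%R by apply: sumr_ge0.
have n0 : (0 <= n%:R :> R)%R by [].
have K0 : (0 <= K)%R by rewrite !addr_ge0.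
have KN : (K <= 2 ^+ N)%R.
  apply: (@le_trans _ _ N%:R); last by rewrite -natrX ler_nat ltnW// ltn_expl.
  exact/ltW/truncnS_gt.
have N0 : (0 < 2 ^+ N :> R)%R by rewrite exprn_gt0.
pose a i := (Num.truncn (2 ^+ N * q i)).+1.
have a1 i : (2 ^+ N * q i <= (a i)%:R)%R by exact/ltW/truncnS_gt.
have a2 i : ((a i)%:R <= 2 ^+ N * q i + 1)%R.
  by rewrite /a -natr1 lerD2r truncn_le// mulr_ge0// ltW.
have := H0 N a; rewrite ge0_sume_distrr; last first.
  by move=> i _; rewrite mule_ge0// lee_fin.
move=> H1; apply: le_trans (H1 _ _).
- apply: lee_sum => i _; rewrite muleA -EFinM lee_wpmul2r//.
  by rewrite lee_fin ler_pdivlMl.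
- move=> i; have [_] := dP i; apply: le_trans.
  rewrite lee_fin ler_pdivrMr// mulrDl natrD (mulrC (q i)).
  have : (3 <= d i * 2 ^+ N)%R.
    rewrite -ler_pdivrMl// mulrC; apply: le_trans KN.
    rewrite /K (bigD1 i)//= -!addrA lerDl !addr_ge0//.
    by apply: sumr_ge0 => j _; rewrite divr_ge0// ltW.
  have := a2 i; lra.
- rewrite -(ler_nat R) natr_sum natrX (_ : 4 = 2 * 2)%R; last by rewrite -natrM.
  rewrite exprMn; apply: (@le_trans _ _ (\sum_i (2 ^+ N * q i + 1)))%R.
    exact: ler_sum.
  rewrite big_split/= -mulr_sumr sumr_const card_ord.
  have h1 : (n%:R <= 2 ^+ N * n%:R :> R)%R by rewrite ler_peMl// exprn_ege1// ler1n.
  apply: (@le_trans _ _ (2 ^+ N * (\sum_i q i + n%:R))%R).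
    by rewrite mulrDr lerD2l.
  rewrite ler_pM2l//; apply: le_trans KN; rewrite /K -addrA lerDr//.
Qed.

Lemma ereal_sup_adde_le (I : Type) (x : I -> \bar R) c J :
  $| I | -> (forall i, 0 <= x i) -> 0 <= c ->
  (forall i, x i + c <= J) -> ereal_sup (range x) + c <= J.
Proof.
move=> [i0] x0 c0 H0.
have xJ : 0 <= ereal_sup (range x).
  by apply: le_trans (x0 i0) _; apply: ereal_sup_ubound; exists i0.
case: c c0 H0 => [c||]// c0 H0; last first.
  have := H0 i0; rewrite addey ?leye_eq; last by case: (x i0) (x0 i0).
  by move=> /eqP ->; exact: leey.
rewrite -leeBrDr//; apply: ge_ereal_sup => _ [i _ <-].
by rewrite leeBrDr.
Qed.

Lemma ereal_sup_sum_le (I : Type) (m : nat) (x : 'I_m -> I -> \bar R) c J :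
  $| I | -> (forall k i, 0 <= x k i) -> 0 <= c ->
  (forall i j, exists l, forall k, x k i <= x k l /\ x k j <= x k l) ->
  (forall i, \sum_k x k i + c <= J) ->
  \sum_k ereal_sup (range (x k)) + c <= J.
Proof.
move=> I0; elim: m x c => [|m IH] x c x0 c0 dx H0.
  by case: I0 => i0; have := H0 i0; rewrite !big_ord0.
rewrite big_ord_recl -addeA; apply: ereal_sup_adde_le => //.
  rewrite adde_ge0// sume_ge0// => k _; case: I0 => i0.
  by apply: le_trans (x0 (lift ord0 k) i0) _; apply: ereal_sup_ubound; exists i0.
move=> i; rewrite addeCA; apply: IH => //.
- by rewrite adde_ge0.
- by move=> a b; have [l lP] := dx a b; exists l => k; exact: lP.
- move=> j; have [l lP] := dx i j; apply: le_trans (H0 l).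
  rewrite big_ord_recl addeCA -addeA; apply: leeD; first by case: (lP ord0).
  by rewrite leeD2r// lee_sum// => k _; case: (lP (lift ord0 k)).
Qed.

End ereal_approx.

Section lsc.
Context (R : realType) (X : topologicalType).
Implicit Types (g f : X -> \bar R).

Lemma lsc_open g (a : R) : lsc_ge0 g -> open [set x | a%:E < g x].
Proof. by case=> _ /lower_semicontinuousP; exact. Qed.

Lemma lscP g : (forall x, 0 <= g x) ->
  (forall a : R, open [set x | a%:E < g x]) -> lsc_ge0 g.
Proof. by move=> g0 og; split => //; exact/lower_semicontinuousP. Qed.

Lemma lsc_add g f : lsc_ge0 g -> lsc_ge0 f -> lsc_ge0 (fun x => g x + f x).
Proof.
move=> lg lf; have [g0 _] := lg; have [f0 _] := lf.
apply: lscP => [x|a]; first by rewrite adde_ge0.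
rewrite (_ : [set x | _] =
    \bigcup_b ([set x | b%:E < g x] `&` [set x | (a - b)%:E < f x])).
  by apply: bigcup_open => b _; apply: openI; exact: lsc_open.
apply/seteqP; split => [x /= agf|x [b _ [/= bg abf]]]; last first.
  by rewrite -(subrK b a) addrC EFinD lteD.
suff [b [bg bf]] : exists b : R, b%:E < g x /\ (a - b)%:E < f x by exists b.
have := g0 x; have := f0 x; move: agf.
case: (g x) => [u||]//; case: (f x) => [v||]//.
- rewrite -EFinD lte_fin !lee_fin => auv v0 u0.
  by exists (u - (u + v - a) / 2)%R; split; rewrite lte_fin; lra.
- by move=> _ _ u0; exists (u - 1)%R; split; rewrite ?ltry// lte_fin; lra.
- rewrite lee_fin => _ v0 _; exists (a + 1)%R.
  by split; rewrite ?ltry// lte_fin; lra.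
- by move=> _ _ _; exists a; split; rewrite ltry.
Qed.

Lemma lsc_cst0 : lsc_ge0 (fun _ : X => 0 : \bar R).
Proof.
apply: lscP => // a; have [a0|a0] := ltP (a%:E) 0.
  rewrite (_ : [set _ | _] = setT); first exact: openT.
  by apply/seteqP; split => // x _ /=.
rewrite (_ : [set _ | _] = set0); first exact: open0.
by apply/seteqP; split => // x /=; rewrite ltNge a0.
Qed.

Lemma lsc_sum (I : Type) (s : seq I) (g : I -> X -> \bar R) :
  (forall i, lsc_ge0 (g i)) -> lsc_ge0 (fun x => \sum_(i <- s) g i x).
Proof.
move=> lg; elim: s => [|i s IH].
  by under eq_fun do rewrite big_nil; exact: lsc_cst0.
by under eq_fun do rewrite big_cons; exact: lsc_add.
Qed.

Lemma lsc_scale (h : R) g : (0 < h)%R -> lsc_ge0 g ->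
  lsc_ge0 (fun x => h%:E * g x).
Proof.
move=> h0 lg; have [g0 _] := lg; apply: lscP => [x|a].
  by rewrite mule_ge0// lee_fin ltW.
rewrite (_ : [set _ | _] = [set x | (h^-1 * a)%:E < g x]); first exact: lsc_open.
apply/seteqP; split => x /=; have := g0 x; case: (g x) => [u||]// _.
- by rewrite -EFinM !lte_fin ltr_pdivrMl.
- by rewrite ltry.
- by rewrite -EFinM !lte_fin ltr_pdivrMl.
- by move=> _; rewrite mulry gtr0_sg// mul1e ltry.
Qed.

Lemma lsc_sup (I : Type) (g : I -> X -> \bar R) : $| I | ->
  (forall i, lsc_ge0 (g i)) ->
  lsc_ge0 (fun x => ereal_sup (range (g ^~ x))).
Proof.
move=> [i0] lg; apply: lscP => [x|a].
  have [g0 _] := lg i0.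
  by apply: le_trans (g0 x) _; apply: ereal_sup_ubound; exists i0.
rewrite (_ : [set _ | _] = \bigcup_i [set x | a%:E < g i x]).
  by apply: bigcup_open => i _; exact: lsc_open.
apply/seteqP; split => x /=.
  by move=> /ereal_sup_gt[_ [i _ <-] agi]; exists i.
by move=> [i _ /= agi]; apply: lt_le_trans agi _; apply: ereal_sup_ubound; exists i.
Qed.

Lemma lsc_indic (U : set X) : open U -> lsc_ge0 (fun x => (\1_U x)%:E : \bar R).
Proof.
move=> oU; apply: lscP => [x|a]; first by rewrite lee_fin indicE.
have [a0|a0] := ltP a 0%R; last have [a1|a1] := ltP a 1%R.
- rewrite (_ : [set _ | _] = setT); first exact: openT.
  by apply/seteqP; split => // x _ /=; rewrite lte_fin (lt_le_trans a0).
- suff -> : [set x | a%:E < (\1_U x)%:E] = U by [].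
  apply/seteqP; split => x /=; rewrite lte_fin indicE.
    by case: (boolP (x \in U)) => [/set_mem//|_]; rewrite ltNge a0.
  by move=> /mem_set ->.
- rewrite (_ : [set _ | _] = set0); first exact: open0.
  apply/seteqP; split => // x /=; rewrite lte_fin indicE.
  by case: (x \in U); rewrite ltNge ?a1// a0.
Qed.

End lsc.

Lemma lsc_comp (R : realType) (X Y : topologicalType) (f : continuousType X Y)
  (g : Y -> \bar R) : lsc_ge0 g -> lsc_ge0 (g \o f).
Proof.
move=> lg; apply: lscP => [x|a]; first by case: lg => g0 _; exact: g0.
exact: (cts_open f (lsc_open a lg)).
Qed.

Section vext.
Context (R : realType) (X : topologicalType).
Implicit Types (nu : valuation R X) (U W : set X).

Definition vext nu U : \bar R :=
  if pselect (open U) is left oU then nu (OpenSet oU) else 0.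

Lemma vextE nu (U : open_set X) : vext nu U = nu U.
Proof.
rewrite /vext; case: pselect => [oU|]; last by case: U.
by congr (vfun nu _); exact: open_set_eq.
Qed.

Lemma vext_open nu U (oU : open U) : vext nu U = nu (OpenSet oU).
Proof. exact: (vextE nu (OpenSet oU)). Qed.

Lemma vext_ge0 nu U : 0 <= vext nu U.
Proof. by rewrite /vext; case: pselect => // oU; exact: v_ge0. Qed.

Lemma vext0 nu : vext nu set0 = 0.
Proof. by rewrite (vext_open _ open0) v_set0. Qed.

Lemma vext_modular nu U W : open U -> open W ->
  vext nu (U `|` W) + vext nu (U `&` W) = vext nu U + vext nu W.
Proof.
move=> oU oW; rewrite (vext_open _ oU) (vext_open _ oW) -v_modular.
by rewrite (vext_open _ (openU oU oW)) (vext_open _ (openI oU oW)).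
Qed.

Lemma vext_directed nu (I : Type) (U : I -> set X) : (forall i, open (U i)) ->
  directed U -> vext nu (\bigcup_i U i) = ereal_sup (range (fun i => vext nu (U i))).
Proof.
move=> oU dU.
have := @v_directed _ _ nu I (fun i => OpenSet (oU i)) dU.
rewrite -vextE/= => ->; congr ereal_sup; congr (_ @` _).
by apply/funext => i; rewrite /= -vextE.
Qed.

Lemma le_vext nu U W : open U -> open W -> U `<=` W -> vext nu U <= vext nu W.
Proof.
move=> oU oW UW; pose F (b : bool) := if b then W else U.
have -> : W = \bigcup_b F b.
  by apply/seteqP; split => [x Wx|x [[] _]]; [exists true|exact|exact: UW].
rewrite vext_directed; last 2 first.
- by case.
- by split; [exact: (squash true)|move=> i j; exists true => x [];
    case: i; case: j => //=; exact: UW].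
by apply: ereal_sup_ubound; exists false.
Qed.

Lemma vextU_le nu U W : open U -> open W ->
  vext nu (U `|` W) <= vext nu U + vext nu W.
Proof. by move=> oU oW; rewrite -vext_modular// leeDl// vext_ge0. Qed.

End vext.

Section levels.
Context (R : realType) (X : topologicalType) (nu : valuation R X).
Implicit Types (L : seq (open_set X)).

Definition cnt L (x : X) : nat := \sum_(U <- L) `[< oset U x >].

Definition lev L (j : nat) : set X := [set x | (j <= cnt L x)%N].

Lemma cnt_cons U L x : cnt (U :: L) x = (`[< oset U x >] + cnt L x)%N.
Proof. by rewrite /cnt big_cons. Qed.

Lemma cnt_size L x : (cnt L x <= size L)%N.
Proof.
elim: L => [|U L IH]; first by rewrite /cnt big_nil.
by rewrite cnt_cons /= -add1n leq_add// leq_b1.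
Qed.

Lemma lev0 L : lev L 0 = setT.
Proof. by apply/seteqP; split. Qed.

Lemma lev_cons U L j : lev (U :: L) j.+1 = lev L j.+1 `|` (U `&` lev L j).
Proof.
apply/seteqP; split => x /=; rewrite /lev /= cnt_cons; case: asboolP => Ux /=.
- by rewrite add1n ltnS => jL; right.
- by rewrite add0n => jL; left.
- by rewrite add1n ltnS => -[/ltnW|[]].
- by rewrite add0n => -[|[]].
Qed.

Lemma lev_decr L j : lev L j.+1 `<=` lev L j.
Proof. by move=> x; exact: ltnW. Qed.

Lemma lev_open L j : open (lev L j).
Proof.
elim: L j => [|U L IH] [|j]; rewrite ?lev0; try exact: openT.
  rewrite (_ : lev _ _ = set0); first exact: open0.
  by apply/seteqP; split => // x; rewrite /lev/= /cnt big_nil.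
rewrite lev_cons; apply: openU; first exact: IH.
by apply: openI; [exact: oset_open|exact: IH].
Qed.

Lemma lev_big L j : (size L < j)%N -> lev L j = set0.
Proof.
move=> Lj; apply/seteqP; split => // x /= jL.
by have := leq_trans Lj (leq_trans jL (cnt_size L x)); rewrite ltnn.
Qed.

Lemma sum_lev L : \sum_(U <- L) nu U = \sum_(k < size L) vext nu (lev L k.+1).
Proof.
elim: L => [|U L IH]; first by rewrite big_nil big_ord0.
have claim j : \sum_(k < j) vext nu (lev (U :: L) k.+1) + vext nu (U `&` lev L j)
    = \sum_(k < j) vext nu (lev L k.+1) + nu U.
  elim: j => [|j IHj]; first by rewrite !big_ord0 lev0 setIT vextE.
  rewrite !big_ord_recr/= -addeA lev_cons.
  have -> : U `&` lev L j.+1 = lev L j.+1 `&` (U `&` lev L j).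
    apply/seteqP; split => x; last by case=> ? [].
    by move=> [Ux Lx]; split => //; split => //; exact: lev_decr.
  rewrite vext_modular; last 2 first.
  - exact: lev_open.
  - by apply: openI; [exact: oset_open|exact: lev_open].
  by rewrite addeCA IHj addeCA addeA.
have := claim (size L).+1.
rewrite (lev_big (ltnSn _)) setI0 vext0 adde0 => ->.
by rewrite big_cons big_ord_recr/= (lev_big (ltnSn _)) vext0 adde0 IH addeC.
Qed.

Lemma sum_lev_ge L m : (size L <= m)%N ->
  \sum_(U <- L) nu U = \sum_(k < m) vext nu (lev L k.+1).
Proof.
move=> Lm; rewrite sum_lev -(subnK Lm) addnC big_split_ord/=.
rewrite [X in _ + X]big1 ?adde0// => i _.
by rewrite lev_big ?vext0// ltnS leq_addr.
Qed.

Lemma le_sum_cnt L K : (forall x, (cnt L x <= cnt K x)%N) ->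
  \sum_(U <- L) nu U <= \sum_(U <- K) nu U.
Proof.
move=> LK; rewrite (@sum_lev_ge L (size L + size K)) ?leq_addr//.
rewrite (@sum_lev_ge K (size L + size K)) ?leq_addl//.
apply: lee_sum => k _; apply: le_vext; [exact: lev_open..|].
by move=> x /= kL; exact: leq_trans kL (LK x).
Qed.

Lemma cnt_cat L K x : cnt (L ++ K) x = (cnt L x + cnt K x)%N.
Proof. by rewrite /cnt big_cat. Qed.

Definition rep n (a : 'I_n -> nat) (U : 'I_n -> open_set X) :=
  flatten [seq nseq (a i) (U i) | i <- enum 'I_n].

Lemma cnt_rep n (a : 'I_n -> nat) (U : 'I_n -> open_set X) x :
  cnt (rep a U) x = (\sum_i a i * `[< oset (U i) x >])%N.
Proof.
rewrite /cnt /rep big_flatten big_map big_enum/=; apply: eq_bigr => i _.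
by elim: (a i) => [|m IH]; rewrite /= ?big_nil// big_cons IH mulSn.
Qed.

Lemma sum_rep n (a : 'I_n -> nat) (U : 'I_n -> open_set X) :
  \sum_(W <- rep a U) nu W = \sum_(i < n) (a i)%:R%:E * nu (U i).
Proof.
rewrite /rep big_flatten big_map big_enum/=; apply: eq_bigr => i _.
elim: (a i) => [|m IH]; rewrite /= ?big_nil ?mul0e// big_cons IH.
by rewrite -natr1 EFinD ge0_muleDl// mul1e addeC.
Qed.

End levels.

Section dyadic.
Context (R : realType) (X : topologicalType).
Implicit Types (nu : valuation R X) (g f : X -> \bar R).

Definition sup_level g (h : R) (k : nat) : set X := [set x | (k.+1%:R * h)%:E < g x].

Definition dy nu N g : \bar R :=
  (2 ^- N)%:E * \sum_(k < 4 ^ N) vext nu (sup_level g (2 ^- N) k).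

Definition dyseq N g (lg : lsc_ge0 g) : seq (open_set X) :=
  [seq OpenSet (lsc_open (k.+1%:R * 2 ^- N)%R lg) | k <- iota 0 (4 ^ N)].

Lemma dyE nu N g (lg : lsc_ge0 g) :
  dy nu N g = (2 ^- N)%:E * \sum_(U <- dyseq N lg) nu U.
Proof.
rewrite /dy /dyseq; congr (_ * _).
rewrite big_map (_ : iota 0 (4 ^ N) = index_iota 0 (4 ^ N)); last first.
  by rewrite /index_iota subn0.
rewrite big_mkord; apply: eq_bigr => k _.
by rewrite -vextE.
Qed.

Definition lcnt g (h : R) (m : nat) (x : X) : nat :=
  (\sum_(0 <= k < m) `[< sup_level g h k x >])%N.

Lemma lcnt_lt g h m x : (0 < h)%R -> (lcnt g h m x < m)%N ->
  g x <= ((lcnt g h m x).+1%:R * h)%:E.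
Proof.
move=> h0; elim: m => // m IH.
rewrite /lcnt big_nat_recr//= -/(lcnt g h m x).
have lem : (lcnt g h m x <= m)%N.
  rewrite /lcnt; apply: leq_trans (_ : \sum_(0 <= k < m) 1 <= _)%N.
    by apply: leq_sum => i _; exact: leq_b1.
  by rewrite sum_nat_const_nat subn0 muln1.
case: asboolP => /= [mx|]; last first.
  rewrite addn0 => /negP; rewrite -leNgt => gm _.
  move: lem; rewrite leq_eqVlt => /orP[/eqP lm|]; last exact: IH.
  by rewrite lm.
rewrite addn1 ltnS => lm.
exfalso; move: mx; rewrite /sup_level/= ltNge => /negP; apply.
apply: le_trans (IH lm) _; rewrite lee_fin ler_pM2r// ler_nat.
by rewrite ltnS.
Qed.

Lemma lcnt_gt0 g h m x : (0 < h)%R -> (0 < lcnt g h m x)%N ->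
  ((lcnt g h m x)%:R * h)%:E < g x.
Proof.
move=> h0; elim: m => [|m IH]; first by rewrite /lcnt big_nil.
rewrite /lcnt big_nat_recr//= -/(lcnt g h m x).
case: asboolP => /= [mx _|_]; last by rewrite addn0.
have lem : (lcnt g h m x <= m)%N.
  rewrite /lcnt; apply: leq_trans (_ : \sum_(0 <= k < m) 1 <= _)%N.
    by apply: leq_sum => i _; exact: leq_b1.
  by rewrite sum_nat_const_nat subn0 muln1.
apply: le_lt_trans mx; rewrite lee_fin ler_pM2r// ler_nat addn1.
by rewrite ltnS.
Qed.

Lemma cnt_dyseq N g (lg : lsc_ge0 g) x :
  cnt (dyseq N lg) x = lcnt g (2 ^- N) (4 ^ N) x.
Proof. by rewrite /cnt /dyseq big_map /lcnt /index_iota subn0. Qed.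

Lemma dy_ge0 nu N g : 0 <= dy nu N g.
Proof. by rewrite mule_ge0// sume_ge0// => k _; exact: vext_ge0. Qed.

Let h0 N : (0 < 2 ^- N :> R)%R.
Proof. by rewrite invr_gt0 exprn_gt0. Qed.

Lemma sum_indic_lcnt g (h : R) m x : 
  (\sum_(k < m) h * \1_(sup_level g h k) x)%R = ((lcnt g h m x)%:R * h)%R.
Proof.
rewrite -mulr_sumr mulrC; congr (_ * _)%R.
rewrite /lcnt big_mkord natr_sum; apply: eq_bigr => k _.
by rewrite indicE; congr ((_ : bool)%:R)%R; rewrite /in_mem/= /in_set.
Qed.

Lemma dy_le_vint nu N g : lsc_ge0 g -> dy nu N g <= vint nu g.
Proof.
move=> lg; apply: ereal_sup_ubound.
exists (4 ^ N)%N, (fun=> (2 ^- N)%:E),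
  (fun k => OpenSet (lsc_open (k.+1%:R * 2 ^- N)%R lg)); split => /=.
- by move=> _; rewrite lte_fin.
- move=> x; under eq_bigr do rewrite -EFinM.
  rewrite sumEFin sum_indic_lcnt.
  have [->|] := eqVneq (lcnt g (2 ^- N) (4 ^ N) x) 0%N.
    by rewrite mul0r; case: lg.
  by rewrite -lt0n => /(lcnt_gt0 (h0 N)) /ltW.
- rewrite /dy ge0_sume_distrr; last by move=> k _; exact: vext_ge0.
  by apply: eq_bigr => k _; rewrite -vextE.
Qed.

Definition dysup nu g := ereal_sup (range (dy nu ^~ g)).

Lemma simple_le_dysup nu g f n (r : 'I_n -> \bar R) (U : 'I_n -> open_set X) :
  lsc_ge0 g -> lsc_ge0 f -> (forall i, 0 < r i) ->
  (forall x, \sum_(i < n) r i * (\1_(U i) x)%:E <= g x + f x) ->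
  \sum_(i < n) r i * nu (U i) <= dysup nu g + dysup nu f.
Proof.
move=> lg lf r0 rU; apply: le_sum_dyadic => // [i|N a ar aN]; first exact: v_ge0.
apply: (@le_trans _ _ (dy nu N g + dy nu N f)); last first.
  by apply: leeD; apply: ereal_sup_ubound; exists N.
rewrite (dyE _ _ lg) (dyE _ _ lf) -ge0_muleDr; last 2 first.
- by apply: sume_ge0 => V _; exact: v_ge0.
- by apply: sume_ge0 => V _; exact: v_ge0.
rewrite lee_pmul2l// -sum_rep -big_cat; apply: le_sum_cnt => x.
rewrite cnt_cat !cnt_dyseq cnt_rep.
set c := (\sum_i _)%N; set c1 := lcnt g _ _ _; set c2 := lcnt f _ _ _.
have [->//|] := eqVneq c 0%N; rewrite -lt0n => c0.
rewrite leqNgt; apply/negP => c12.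
have cN : (c <= 4 ^ N)%N.
  apply: leq_trans aN; apply: leq_sum => i _.
  by rewrite -[leqRHS]muln1 leq_mul2l leq_b1 orbT.
have c1N : (c1 < 4 ^ N)%N by lia.
have c2N : (c2 < 4 ^ N)%N by lia.
have gx := lcnt_lt (h0 N) c1N; have fx := lcnt_lt (h0 N) c2N.
have := rU x; apply/negP; rewrite -ltNge.
apply: le_lt_trans (leeD gx fx) _.
apply: (@lt_le_trans _ _ ((c + 2)%:R * 2 ^- N)%:E).
  rewrite -EFinD lte_fin -mulrDl ltr_pM2r// -natrD ltr_nat; lia.
apply: (@le_trans _ _ (\sum_(i < n) ((a i + 2)%:R * 2 ^- N)%:E * (\1_(U i) x)%:E)); last first.
  by apply: lee_sum => i _; rewrite lee_wpmul2r// lee_fin indicE.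
under eq_bigr do rewrite -EFinM mulrAC.
rewrite sumEFin lee_fin -mulr_suml ler_pM2r//.
rewrite (_ : \sum_i _ = (\sum_i (a i + 2) * `[< oset (U i) x >])%:R)%R; last first.
  rewrite natr_sum; apply: eq_bigr => i _; rewrite natrM indicE.
  by congr (_ * (_ : bool)%:R)%R; rewrite /in_mem/= /in_set.
rewrite ler_nat.
have -> : (\sum_i (a i + 2) * `[< oset (U i) x >] = c + \sum_i 2 * `[< oset (U i) x >])%N.
  by rewrite -big_split/=; apply: eq_bigr => i _; rewrite mulnDl.
rewrite leq_add2l.
have [i Ui] : exists i, oset (U i) x.
  apply: contrapT => nU; move: c0; rewrite /c big1// => i _.
  by case: asboolP => [Ui|]; [exfalso; apply: nU; exists i|rewrite muln0].
rewrite (bigD1 i)//=; case: asboolP => // _; by rewrite muln1 leq_addr.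
Qed.

Lemma dysup_cst0 nu : dysup nu (fun=> 0) = 0.
Proof.
apply/eqP; rewrite eq_le; apply/andP; split; last first.
  by apply: le_trans (dy_ge0 nu 0 (fun=> 0)) _; apply: ereal_sup_ubound; exists 0%N.
apply: ge_ereal_sup => _ [N _ <-]; rewrite /dy big1 ?mule0// => k _.
rewrite (_ : sup_level _ _ _ = set0) ?vext0//.
apply/seteqP; split => // x; rewrite /sup_level /= lte_fin ltNge => /negP.
by apply; rewrite mulr_ge0// ltW.
Qed.

Lemma vintE nu g : lsc_ge0 g -> vint nu g = dysup nu g.
Proof.
move=> lg; apply/eqP; rewrite eq_le; apply/andP; split.
  apply: ge_ereal_sup => _ [n [r [U [r0 rU ->]]]].
  rewrite -[leRHS]adde0 -[X in _ <= _ + X](dysup_cst0 nu); apply: simple_le_dysup => //.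
    exact: lsc_cst0.
  by move=> x; rewrite adde0.
by apply: ge_ereal_sup => _ [N _ <-]; exact: dy_le_vint.
Qed.

Lemma vint_ge0 nu g : (forall x, 0 <= g x) -> 0 <= vint nu g.
Proof.
move=> g0; apply: ereal_sup_ubound; exists 0%N, (fun=> 1), (fun=> OpenSet open0).
by split => [//|x|]; rewrite big_ord0.
Qed.

Lemma le_vint nu g f : (forall x, g x <= f x) -> vint nu g <= vint nu f.
Proof.
move=> gf; apply: ereal_sup_le => _ [n [r [U [r0 rU ->]]]].
by exists n, r, U; split => // x; exact: le_trans (rU x) (gf x).
Qed.

Lemma vintD nu g f : lsc_ge0 g -> lsc_ge0 f ->
  vint nu (fun x => g x + f x) = vint nu g + vint nu f.
Proof.
move=> lg lf; have [g0 _] := lg; have [f0 _] := lf.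
apply/eqP; rewrite eq_le; apply/andP; split.
  apply: ge_ereal_sup => _ [n [r [U [r0 rU ->]]]].
  by rewrite (vintE nu lg) (vintE nu lf); exact: simple_le_dysup.
rewrite (vintE nu lg) (vintE nu lf); apply: ereal_sup_adde_le.
- exact: (squash 0%N).
- by move=> N; exact: dy_ge0.
- by rewrite -vintE//; exact: vint_ge0.
move=> N; rewrite addeC; apply: ereal_sup_adde_le.
- exact: (squash 0%N).
- by move=> M; exact: dy_ge0.
- exact: dy_ge0.
move=> M; rewrite addeC; apply: ereal_sup_ubound.
pose s (k : X -> \bar R) (l : lsc_ge0 k) N (i : 'I_(4 ^ N)) :=
  OpenSet (lsc_open (i.+1%:R * 2 ^- N)%R l).
pose r (i : 'I_(4 ^ N + 4 ^ M)) : \bar R :=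
  match fintype.split i with inl _ => (2 ^- N)%:E | inr _ => (2 ^- M)%:E end.
pose U (i : 'I_(4 ^ N + 4 ^ M)) : open_set X :=
  match fintype.split i with inl i => s g lg N i | inr i => s f lf M i end.
have lr (F : \bar R -> open_set X -> \bar R) : \sum_i F (r i) (U i) =
    \sum_i F (2 ^- N)%:E (s g lg N i) + \sum_i F (2 ^- M)%:E (s f lf M i).
  rewrite big_split_ord/=; congr (_ + _); apply: eq_bigr => i _.
    by rewrite /r /U -[lshift _ _]/(unsplit (inl i)) unsplitK.
  by rewrite /r /U -[rshift _ _]/(unsplit (inr i)) unsplitK.
have le k P x : lsc_ge0 k -> \sum_(i < 4 ^ P)
    ((2 ^- P)%:E : \bar R) * (\1_(sup_level k (2 ^- P) i) x)%:E <= k x.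
  move=> lk; under eq_bigr do rewrite -EFinM.
  rewrite sumEFin sum_indic_lcnt.
  have [->|] := eqVneq (lcnt k (2 ^- P) (4 ^ P) x) 0%N.
    by rewrite mul0r; case: lk.
  by rewrite -lt0n => /(lcnt_gt0 (h0 P)) /ltW.
exists (4 ^ N + 4 ^ M)%N, r, U; split.
- by move=> i; rewrite /r; case: (fintype.split i) => _; rewrite lte_fin.
- by move=> x; rewrite (lr (fun r U => r * (\1_U x)%:E)); apply: leeD; exact: le.
- rewrite (lr (fun r U => r * nu U)) /dy.
  by congr (_ + _); rewrite ge0_sume_distrr; try (by move=> k _; exact: vext_ge0);
    apply: eq_bigr => i _; rewrite -vextE.
Qed.

Lemma vint_cst0 nu : vint nu (fun=> 0) = 0.
Proof. by rewrite vintE ?dysup_cst0//; exact: lsc_cst0. Qed.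

Lemma vint_sum nu (I : Type) (s : seq I) (g : I -> X -> \bar R) :
  (forall i, lsc_ge0 (g i)) ->
  vint nu (fun x => \sum_(i <- s) g i x) = \sum_(i <- s) vint nu (g i).
Proof.
move=> lg; elim: s => [|i s IH].
  by under eq_fun do rewrite big_nil; rewrite big_nil vint_cst0.
under eq_fun do rewrite big_cons.
by rewrite big_cons vintD// ?IH//; exact: lsc_sum.
Qed.

Lemma vintZ nu (h : R) g : (0 < h)%R ->
  vint nu (fun x => h%:E * g x) = h%:E * vint nu g.
Proof.
have le (k : R) f : (0 < k)%R -> k%:E * vint nu f <= vint nu (fun x => k%:E * f x).
  move=> k0; rewrite -ereal_sup_pZl//; apply: ereal_sup_le.
  move=> _ [_ [n [r [U [r0 rU ->]]]] <-].
  exists n, (fun i => k%:E * r i), U; split.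
  - by move=> i; rewrite mule_gt0.
  - move=> x; under eq_bigr do rewrite -muleA.
    rewrite -ge0_sume_distrr ?lee_pmul2l//.
    by move=> i _; apply: mule_ge0; [exact: ltW|rewrite lee_fin indicE].
  - rewrite ge0_sume_distrr; first by apply: eq_bigr => i _; rewrite muleA.
    by move=> i _; rewrite mule_ge0 ?v_ge0// ltW.
move=> hp; apply/eqP; rewrite eq_le le// andbT.
have hi : (0 < h^-1)%R by rewrite invr_gt0.
have := le h^-1%R (fun x => h%:E * g x) hi.
under [X in _ <= vint nu X -> _]eq_fun do
  rewrite muleA -EFinM mulVf ?gt_eqF// mul1e.
rewrite -(@lee_pmul2l _ h%:E)// ?lte_fin//.
by rewrite muleA -EFinM mulfV ?gt_eqF// mul1e.
Qed.

Lemma vint_sup nu (I : Type) (g : I -> X -> \bar R) : $| I | ->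
  (forall i, lsc_ge0 (g i)) ->
  (forall i j, exists k, forall x, g i x <= g k x /\ g j x <= g k x) ->
  vint nu (fun x => ereal_sup (range (g ^~ x))) = ereal_sup (range (fun i => vint nu (g i))).
Proof.
move=> I0 lg dg; apply/eqP; rewrite eq_le; apply/andP; split; last first.
  apply: ge_ereal_sup => _ [i _ <-]; apply: le_vint => x.
  by apply: ereal_sup_ubound; exists i.
rewrite vintE; last exact: lsc_sup.
apply: ge_ereal_sup => _ [N _ <-].
have lev_sup k : sup_level (fun x => ereal_sup (range (g ^~ x))) (2 ^- N) k =
    \bigcup_i sup_level (g i) (2 ^- N) k.
  apply/seteqP; split => x.
    by move=> /ereal_sup_gt[_ [i _ <-] agi]; exists i.
  by move=> [i _ /= agi]; apply: lt_le_trans agi _; apply: ereal_sup_ubound; exists i.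
have osl i k : open (sup_level (g i) (2 ^- N) k) by exact: lsc_open.
rewrite /dy.
under eq_bigr => k _.
  rewrite lev_sup vext_directed//; last first.
    split => // i j; have [l lP] := dg i j; exists l => x [] /lt_le_trans; apply;
      by case: (lP x).
  over.
rewrite -lee_pdivlMl// -[leLHS]adde0.
apply: (@ereal_sup_sum_le _ _ _
  (fun (k : 'I_(4 ^ N)) i => vext nu (sup_level (g i) (2 ^- N) k))) => //.
- by move=> k i; exact: vext_ge0.
- move=> i j; have [l lP] := dg i j; exists l => k.
  by split; apply: le_vext => // x /lt_le_trans; apply; case: (lP x).
- move=> i; rewrite adde0 lee_pdivlMl//.
  apply: (@le_trans _ _ (vint nu (g i))); first exact: dy_le_vint.
  by apply: ereal_sup_ubound; exists i.
Qed.

Lemma vint_indic nu (U : open_set X) : vint nu (fun x => (\1_U x)%:E) = nu U.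
Proof.
apply/eqP; rewrite eq_le; apply/andP; split; last first.
  apply: ereal_sup_ubound; exists 1%N, (fun=> 1), (fun=> U).
  by split => [//|x|]; rewrite big_ord1 mul1e.
have lU : lsc_ge0 (fun x => (\1_U x)%:E : \bar R) by apply: lsc_indic; exact: oset_open.
rewrite vintE//; apply: ge_ereal_sup => _ [N _ <-].
have [/set0P[x0 Ux0]|/negP] := boolP ((U : set X) != set0); last first.
  move=> /negP/negPn/eqP U0; rewrite /dy big1 ?mule0 ?v_ge0// => k _.
  rewrite (_ : sup_level _ _ _ = set0) ?vext0//.
  apply/seteqP; split => // x; rewrite /sup_level /= lte_fin ltNge => /negP.
  by apply; rewrite indicE U0 in_set0 mulr_ge0// ltW.
rewrite /dy ge0_sume_distrr; last by move=> k _; exact: vext_ge0.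
have sl k : sup_level (fun x => (\1_U x)%:E) (2 ^- N) k =
   if asbool (sup_level (fun x => (\1_U x)%:E) (2 ^- N) k x0) then (U : set X) else set0.
  rewrite /sup_level/=; apply/seteqP; split => x /=.
    rewrite !lte_fin !indicE; case: (boolP (x \in _)) => [/set_mem Ux|_].
      by rewrite (mem_set Ux0); case: asboolP.
    by rewrite ltNge mulr_ge0// ltW.
  by case: asboolP => // + Ux; rewrite !lte_fin !indicE !mem_set.
apply: (@le_trans _ _ (\sum_(k < 4 ^ N)
    (2 ^- N * \1_(sup_level (fun x => (\1_U x)%:E) (2 ^- N) k) x0)%:E * nu U)).
  apply: lee_sum => k _; rewrite [in leLHS]sl indicE /in_mem/= /in_set.
  by case: asboolP => _; rewrite ?vext0 ?vextE ?mulr1// mule0 mulr0 mul0e.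
rewrite -ge0_sume_distrl; last first.
  by move=> k _; rewrite lee_fin mulr_ge0// ?indicE// ltW.
rewrite sumEFin sum_indic_lcnt -[leRHS]mul1e lee_wpmul2r ?v_ge0//.
set c := lcnt _ _ _ _.
have [->|] := eqVneq c 0%N; first by rewrite mul0r.
rewrite -lt0n => /(lcnt_gt0 (h0 N)) /ltW/le_trans; apply.
by rewrite lee_fin indicE; case: (_ \in _).
Qed.

Lemma dy_nd nu g : lsc_ge0 g ->
  {homo dy nu ^~ g : n m / (n <= m)%N >-> n <= m}.
Proof.
move=> lg; apply: homo_leq => // [x y z|N]; first exact: le_trans.
rewrite !(dyE _ _ lg).
have -> : (2 ^- N)%:E = (2 ^- N.+1)%:E * 2%:E :> \bar R.
  by rewrite -EFinM exprSr invfM mulfVK.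
rewrite -muleA lee_pmul2l//.
have -> : 2%:E * \sum_(U <- dyseq N lg) nu U = \sum_(U <- dyseq N lg ++ dyseq N lg) nu U.
  rewrite big_cat/= -[2%R]/(1 + 1)%R EFinD ge0_muleDl// ?mul1e//.
apply: le_sum_cnt => x; rewrite cnt_cat !cnt_dyseq.
set c := lcnt _ _ _ x; set d := lcnt _ _ _ x.
have [->//|] := eqVneq c 0%N; rewrite -lt0n => c0.
rewrite leqNgt; apply/negP => dc.
have cN : (c <= 4 ^ N)%N.
  rewrite /c /lcnt; apply: leq_trans (_ : \sum_(0 <= k < 4 ^ N) 1 <= _)%N.
    by apply: leq_sum => i _; exact: leq_b1.
  by rewrite sum_nat_const_nat subn0 muln1.
have N0 : (0 < 4 ^ N)%N by rewrite expn_gt0.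
have dN : (d < 4 ^ N.+1)%N by rewrite expnS; lia.
have := lt_le_trans (lcnt_gt0 (h0 N) c0) (lcnt_lt (h0 N.+1) dN).
rewrite lte_fin ltNge => /negP; apply.
rewrite -/c -/d exprSr invfM mulrA -subr_ge0.
have h0N := h0 N; have dcR : ((d.+1)%:R <= c%:R + c%:R :> R)%R by rewrite -natrD ler_nat.
rewrite mulrAC -mulrBl; apply: mulr_ge0; last exact: ltW.
lra.
Qed.

End dyadic.

Section valuation_topology.
Context (R : realType) (X Y : topologicalType).

Lemma vint_lsc (g : X -> \bar R) : lsc_ge0 g ->
  lsc_ge0 (fun nu : valuation R X => vint nu g).
Proof.
move=> lg; apply: lscP => [nu|r]; first by apply: vint_ge0; case: lg.
by apply: gen_topology_open; exists g => //; exists r.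
Qed.

Lemma ev_lsc (U : open_set X) : lsc_ge0 (fun nu : valuation R X => nu U).
Proof.
under eq_fun do rewrite -vint_indic.
by apply/vint_lsc/lsc_indic; exact: oset_open.
Qed.

Lemma valuation_continuous (f : Y -> valuation R X) :
  (forall g, lsc_ge0 g -> lsc_ge0 (fun y => vint (f y) g)) -> continuous f.
Proof.
move=> fg; apply: (@gen_topology_continuous (valuation R X)) => _ [g lg [r ->]].
by have := lsc_open r (fg g lg).
Qed.

End valuation_topology.

Section valuation_map.
Context (R : realType) (X Y : topologicalType) (f : continuousType X Y).

Definition preimage_open_set (U : open_set Y) : open_set X :=
  OpenSet (cts_open f (oset_open U)).

Section map.
Context (nu : valuation R X).

Let m (U : open_set Y) : \bar R := nu (preimage_open_set U).

Let m_ge0 U : 0 <= m U. Proof. exact: v_ge0. Qed.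

Let m_set0 : m (OpenSet open0) = 0.
Proof. by rewrite -(v_set0 nu); congr (vfun nu _); exact: open_set_eq. Qed.

Let m_modular (U W : open_set Y) :
  m (OpenSet (openU (oset_open U) (oset_open W))) +
  m (OpenSet (openI (oset_open U) (oset_open W))) = m U + m W.
Proof.
rewrite -(v_modular nu (preimage_open_set U) (preimage_open_set W)).
by congr (vfun nu _ + vfun nu _); exact: open_set_eq.
Qed.

Let m_directed (I : Type) (U : I -> open_set Y) : directed U ->
  m (bigcup_open_set U) = ereal_sup (range (m \o U)).
Proof.
move=> [I0 dU].
have := @v_directed _ _ nu I (preimage_open_set \o U) _.
have -> : bigcup_open_set (preimage_open_set \o U) =
    preimage_open_set (bigcup_open_set U).
  by apply: open_set_eq; rewrite /= preimage_bigcup.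
apply; split => // i j; have [k kP] := dU i j; exists k => x Ux.
exact: kP.
Qed.

Definition valuation_map : valuation R Y :=
  Valuation m_ge0 m_set0 m_modular m_directed.

End map.

Lemma vint_map nu (g : Y -> \bar R) : lsc_ge0 g ->
  vint (valuation_map nu) g = vint nu (g \o f).
Proof.
move=> lg; rewrite !vintE//; last exact: lsc_comp.
congr ereal_sup; congr (_ @` _); apply/funext => N; rewrite /dy; congr (_ * _).
apply: eq_bigr => k _.
have oU := lsc_open (k.+1%:R * 2 ^- N)%R lg.
have oV := lsc_open (k.+1%:R * 2 ^- N)%R (lsc_comp f lg).
rewrite [LHS](vext_open _ oU) [RHS](vext_open _ oV).
by congr (vfun nu _); exact: open_set_eq.
Qed.

Lemma valuation_map_continuous : continuous valuation_map.
Proof.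
apply: valuation_continuous => g lg.
under eq_fun do rewrite vint_map//.
exact/vint_lsc/lsc_comp.
Qed.

HB.instance Definition _ :=
  isContinuous.Build _ _ valuation_map valuation_map_continuous.

End valuation_map.

Section valuation_unit.
Context (R : realType) (X : topologicalType).

Section unit.
Context (x : X).

Let m (U : open_set X) : \bar R := (\1_U x)%:E.

Let m_ge0 U : 0 <= m U. Proof. by rewrite lee_fin indicE. Qed.

Let m_set0 : m (OpenSet open0) = 0.
Proof. by rewrite /m indicE in_set0. Qed.

Let m_modular (U W : open_set X) :
  m (OpenSet (openU (oset_open U) (oset_open W))) +
  m (OpenSet (openI (oset_open U) (oset_open W))) = m U + m W.
Proof.
rewrite /m/= !indicE in_setU in_setI -!EFinD.
by case: (_ \in _); case: (_ \in _); rewrite /= ?addr0 ?add0r.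
Qed.

Let m_directed (I : Type) (U : I -> open_set X) : directed U ->
  m (bigcup_open_set U) = ereal_sup (range (m \o U)).
Proof.
move=> [[i0] dU]; rewrite /m indicE; case: (boolP (_ \in _)) => [/set_mem[i _ Uix]|nU].
  apply/eqP; rewrite eq_le; apply/andP; split.
    by apply: ereal_sup_ubound; exists i => //=; rewrite indicE mem_set.
  apply: ge_ereal_sup => _ [j _ <-] /=; rewrite lee_fin indicE.
  by case: (_ \in _).
have nUi i : (x \in (U i : set X)) = false.
  apply/negbTE; apply: contra nU => /set_mem Uix; apply: mem_set.
  by exists i.
apply/eqP; rewrite eq_le; apply/andP; split.
  by apply: ereal_sup_ubound; exists i0 => //=; rewrite indicE nUi.
by apply: ge_ereal_sup => _ [j _ <-] /=; rewrite indicE nUi.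
Qed.

Definition valuation_unit : valuation R X :=
  Valuation m_ge0 m_set0 m_modular m_directed.

End unit.

Lemma vint_unit x (g : X -> \bar R) : lsc_ge0 g ->
  vint (valuation_unit x) g = g x.
Proof.
move=> lg; have [g0 _] := lg; apply/eqP; rewrite eq_le; apply/andP; split.
  by apply: ge_ereal_sup => _ [n [r [U [r0 rU ->]]]]; exact: rU.
rewrite leNgt; apply/negP => abs.
have : 0 <= vint (valuation_unit x) g by exact: vint_ge0.
move: abs; case te: (vint (valuation_unit x) g) => [t||]// tg; last first.
  by move: tg; rewrite ltNge leey.
rewrite lee_fin => t0.
have [s st sg] : exists2 s : R, (t < s)%R & s%:E < g x.
  move: tg; case: (g x) => [u||]//.
    by rewrite lte_fin => tu; exists ((t + u) / 2)%R; rewrite ?lte_fin; lra.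
  by move=> _; exists (t + 1)%R; rewrite ?ltry//; lra.
suff : s%:E <= vint (valuation_unit x) g by rewrite te lee_fin leNgt st.
apply: ereal_sup_ubound.
exists 1%N, (fun=> s%:E), (fun=> OpenSet (lsc_open s lg)); split.
- by move=> _; rewrite lte_fin (le_lt_trans t0).
- move=> y; rewrite big_ord1 indicE; case: (boolP (y \in _)) => [/set_mem/=|_].
    by rewrite mule1 => /ltW.
  by rewrite mule0.
- by rewrite big_ord1 /= indicE mem_set ?mule1.
Qed.

Lemma valuation_unit_continuous : continuous valuation_unit.
Proof.
apply: valuation_continuous => g lg.
by under eq_fun do rewrite vint_unit//.
Qed.

HB.instance Definition _ :=
  isContinuous.Build _ _ valuation_unit valuation_unit_continuous.

End valuation_unit.

Section valuation_mult.
Context (R : realType) (X : topologicalType).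

(* Setting g := 1_U in <E xi, g> = <xi, rho |-> <rho, g>> forces this value on U;
   the identity for all g is vint_mult. *)
Section mult.
Context (xi : valuation R (valuation R X)).

Let m (U : open_set X) : \bar R := vint xi (fun rho => rho U).

Let m_ge0 U : 0 <= m U. Proof. by apply: vint_ge0 => rho; exact: v_ge0. Qed.

Let m_set0 : m (OpenSet open0) = 0.
Proof. by rewrite /m; under eq_fun do rewrite v_set0; exact: vint_cst0. Qed.

Let m_modular (U W : open_set X) :
  m (OpenSet (openU (oset_open U) (oset_open W))) +
  m (OpenSet (openI (oset_open U) (oset_open W))) = m U + m W.
Proof.
rewrite /m -!vintD; [|exact: ev_lsc..].
by under eq_fun do rewrite v_modular.
Qed.

Let m_directed (I : Type) (U : I -> open_set X) : directed U ->
  m (bigcup_open_set U) = ereal_sup (range (m \o U)).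
Proof.
move=> dU; have [I0 dU'] := dU; rewrite /m.
under eq_fun do rewrite v_directed//.
rewrite (@vint_sup _ _ xi I (fun i rho => rho (U i)))//.
  by move=> i; exact: ev_lsc.
move=> i j; have [k kP] := dU' i j; exists k => rho; rewrite -!vextE.
by split; apply: le_vext; try exact: oset_open; move=> x Ux; apply: kP; [left|right].
Qed.

Definition valuation_mult : valuation R X :=
  Valuation m_ge0 m_set0 m_modular m_directed.

End mult.

Lemma vint_mult xi (g : X -> \bar R) : lsc_ge0 g ->
  vint (valuation_mult xi) g = vint xi (fun rho => vint rho g).
Proof.
move=> lg.
have lev N k : lsc_ge0 (fun rho : valuation R X => vext rho (sup_level g (2 ^- N) k)).
  under eq_fun do rewrite (vext_open _ (lsc_open (k.+1%:R * 2 ^- N)%R lg)).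
  exact: ev_lsc.
have ldy N : lsc_ge0 (fun rho : valuation R X => dy rho N g).
  by apply: lsc_scale => //; apply: lsc_sum => k; exact: lev.
under [in RHS]eq_fun do rewrite vintE//.
rewrite [LHS]vintE// /dysup (@vint_sup _ _ xi nat (fun N rho => dy rho N g))//; last 2 first.
- exact: (squash 0%N).
- move=> i j; exists (maxn i j) => rho.
  by split; apply: dy_nd => //; rewrite ?leq_maxl ?leq_maxr.
congr ereal_sup; congr (_ @` _); apply/funext => N.
rewrite /dy vintZ// vint_sum//; congr (_ * _); apply: eq_bigr => k _.
have oU := lsc_open (k.+1%:R * 2 ^- N)%R lg.
rewrite [LHS](vext_open _ oU) /=; congr vint; apply/funext => rho.
by rewrite [RHS](vext_open _ oU).
Qed.

Lemma valuation_mult_continuous : continuous valuation_mult.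
Proof.
apply: valuation_continuous => g lg.
under eq_fun do rewrite vint_mult//.
exact/vint_lsc/vint_lsc.
Qed.

HB.instance Definition _ :=
  isContinuous.Build _ _ valuation_mult valuation_mult_continuous.

End valuation_mult.

Definition monadV (R : realType) : monad.
Proof.
apply: (@Monad (fun X => valuation R X) (fun X Y f => @valuation_map R X Y f)
  (fun X => @valuation_unit R X) (fun X => @valuation_mult R X)).
- move=> X t; apply: valuation_eq => U /=.
  by congr (vfun t _); exact: open_set_eq.
- move=> X Y Z f g t; apply: valuation_eq => U /=.
  by congr (vfun t _); exact: open_set_eq.
- by move=> X Y f x; exact: valuation_eq.
- move=> X Y f t; apply: valuation_eq => U /=.
  by rewrite vint_map//; exact: ev_lsc.
- move=> X t; apply: valuation_eq => U /=.
  by rewrite vint_unit//; exact: ev_lsc.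
- move=> X t; apply: valuation_eq => U /=.
  by rewrite vint_map ?vint_indic//; exact: ev_lsc.
- move=> X t; apply: valuation_eq => U /=.
  by rewrite vint_map ?vint_mult//; exact: ev_lsc.
Defined.

Section support.
Context (R : realType) (X : topologicalType).

Let supp_closed (nu : valuation R X) :
  closed [set x | forall U : open_set X, oset U x -> 0 < nu U].
Proof.
move=> x clx U Ux.
have [y [ysupp Uy]] := clx _ (open_nbhs_nbhs (conj (oset_open U) Ux)).
exact: ysupp.
Qed.

(* suppP is the characteristic property. *)
Definition supp (nu : valuation R X) : closed_set X :=
  ClosedSet (@supp_closed nu).

Lemma suppP (nu : valuation R X) (U : open_set X) :
  hit U (supp nu) <-> 0 < nu U.
Proof.
split=> [[x [suppx Ux]]|]; first exact: suppx.
apply: contraPP => nsupp; apply/negP; rewrite -leNgt.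
pose I := {W : seq (open_set X) | vext nu (\big[setU/set0]_(w <- W) oset w) <= 0}.
pose F (W : I) : set X := \big[setU/set0]_(w <- sval W) oset w.
have oF W : open (F W).
  rewrite /F; elim: (sval W) => [|w s IH]; first by rewrite big_nil; exact: open0.
  by rewrite big_cons; apply: openU => //; exact: oset_open.
have dF : directed F.
  split.
    by apply: (squash (exist _ [::] _)); rewrite big_nil vext0.
  move=> i j.
  have ij0 : vext nu (\big[setU/set0]_(w <- sval i ++ sval j) oset w) <= 0.
    rewrite big_cat/=; apply: le_trans (vextU_le _ (oF i) (oF j)) _.
    by have := leeD (svalP i) (svalP j); rewrite adde0.
  by exists (exist _ (sval i ++ sval j) ij0 : I); rewrite /F /= big_cat.
apply: (@le_trans _ _ (vext nu (\bigcup_W F W))).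
  rewrite -vextE; apply: le_vext; [exact: oset_open|exact: bigcup_open|].
  move=> x Ux.
  have [W Wx W0] : exists2 W : open_set X, oset W x & nu W <= 0.
    apply: contrapT => nW; apply: nsupp; exists x; split => // W Wx.
    by rewrite ltNge; apply/negP => W0; apply: nW; exists W.
  have W0' : vext nu (\big[setU/set0]_(w <- [:: W]) oset w) <= 0.
    by rewrite big_seq1 vextE.
  by exists (exist _ [:: W] W0' : I) => //; rewrite /F /= big_seq1.
rewrite vext_directed//; apply: ge_ereal_sup => _ [W _ <-].
exact: (svalP W).
Qed.

End support.

(* A library measure is a function on all sets, constrained only on the
   measurable ones: trunc_prob discards the irrelevant values. *)
Section truncation.
Context d (T : measurableType d) (R : realType) (P : probability T R).

Definition trunc_prob (A : set T) : \bar R := if `[< measurable A >] then P A else 0.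

Lemma trunc_probE A : measurable A -> trunc_prob A = P A.
Proof. by rewrite /trunc_prob; case: asboolP. Qed.

Lemma trunc_prob_out A : ~ measurable A -> trunc_prob A = 0.
Proof. by rewrite /trunc_prob; case: asboolP. Qed.

Let trunc_prob0 : trunc_prob set0 = 0.
Proof. by rewrite trunc_probE// measure0. Qed.

Let trunc_prob_ge0 A : 0 <= trunc_prob A.
Proof. by rewrite /trunc_prob; case: asboolP. Qed.

Let trunc_prob_sigma_additive : semi_sigma_additive trunc_prob.
Proof.
move=> F mF tF mUF; rewrite trunc_probE//.
under eq_fun do (under eq_bigr do rewrite trunc_probE//).
exact: measure_semi_sigma_additive.
Qed.

HB.instance Definition _ := isMeasure.Build _ _ _ trunc_prob
  trunc_prob0 trunc_prob_ge0 trunc_prob_sigma_additive.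

Let trunc_prob_setT : trunc_prob setT = 1.
Proof. by rewrite trunc_probE// probability_setT. Qed.

HB.instance Definition _ := Measure_isProbability.Build _ _ _ trunc_prob trunc_prob_setT.

End truncation.

Lemma probability_eq d (T : measurableType d) (R : realType)
  (P Q : probability T R) : P = Q :> (set T -> \bar R) -> P = Q.
Proof.
move: P Q => [P [[p1 p2] [p3] [p4] [p5] [p6] [p7] [p8]]]
  [Q [[+ +] [+] [+] [+] [+] [+] [+]]] /= PQ.
rewrite -{}PQ => q1 q2 q3 q4 q5 q6 q7 q8.
rewrite (_ : q1 = p1)// (_ : q2 = p2)// (_ : q3 = p3)// (_ : q4 = p4)//.
by rewrite (_ : q5 = p5)// (_ : q6 = p6)// (_ : q7 = p7)// (_ : q8 = p8).
Qed.

(* Measurable types of the library are pointed, whereas topological spaces may be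
   empty. As a probability measure lives on a nonempty space, the Borel space of X
   takes a proof that X is inhabited; the point is irrelevant to the sigma-algebra
   and, by proof irrelevance, does not depend on the proof. *)
Definition inhabited_copy (X : topologicalType) (h : $| X |) : Type := X.

HB.instance Definition _ (X : topologicalType) (h : $| X |) :=
  Choice.on (inhabited_copy h).
HB.instance Definition _ (X : topologicalType) (h : $| X |) :=
  isPointed.Build (inhabited_copy h) (unsquash h).

Definition borel (X : topologicalType) (h : $| X |) :=
  g_sigma_algebraType (@open X : set (set (inhabited_copy h))).

HB.instance Definition _ (X : topologicalType) (h : $| X |) :=
  Measurable.on (borel h).

Definition is_borel (X : topologicalType) (A : set X) := <<s @open X >> A.

Lemma borel_measurableE (X : topologicalType) (h : $| X |) :
  (measurable : set (set (borel h))) = @is_borel X.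
Proof. by []. Qed.

Lemma borel_measurable (X : topologicalType) (h : $| X |) (A : set X) :
  is_borel A -> measurable (A : set (borel h)).
Proof. by []. Qed.

Lemma open_borel (X : topologicalType) (U : set X) : open U -> is_borel U.
Proof. by move=> oU; exact: sub_sigma_algebra. Qed.

Section tau_prob.
Context (R : realType) (X : topologicalType).

(* tp_out makes equality of elements of tau_prob coincide with equality of measures
   on the Borel sets, cf. tau_prob_eq. *)
Record tau_prob := TauProb {
  tp_inh : $| X |;
  tp_prob :> probability (borel tp_inh) R;
  tp_out : forall A : set X, ~ is_borel A -> tp_prob A = 0;
  tp_smooth : forall (I : Type) (U : I -> open_set X), directed U ->
    tp_prob (\bigcup_i U i) = ereal_sup (range (fun i => tp_prob (U i))) }.

Lemma tau_prob_eq (p q : tau_prob) :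
  (forall A : set X, is_borel A -> p A = q A) -> p = q.
Proof.
case: p q => [h p po ps] [h' q qo qs] /= pq.
have hh : h = h' by exact: Prop_irrelevance.
subst h'; have e : p = q.
  apply: probability_eq; apply/funext => A.
  by have [bA|nA] := pselect (is_borel A); [exact: pq|rewrite po// qo].
by subst q; congr TauProb; exact: Prop_irrelevance.
Qed.

Definition tau_integral (p : tau_prob) (g : X -> \bar R) : \bar R :=
  \int[tp_prob p]_x g x.

HB.instance Definition _ := gen_eqMixin tau_prob.
HB.instance Definition _ := gen_choiceMixin tau_prob.
HB.instance Definition _ := Topological.copy tau_prob
  (gen_topology [set A : set tau_prob | exists2 g, lsc_ge0 g &
    exists r : R, A = [set p | r%:E < tau_integral p g]]).

Section make.
Context (h : $| X |) (P : probability (borel h) R).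
Context (smooth : forall (I : Type) (U : I -> open_set X), directed U ->
  P (\bigcup_i U i) = ereal_sup (range (fun i => P (U i)))).

Let out (A : set X) : ~ is_borel A -> trunc_prob P A = 0.
Proof. by move=> nA; exact: trunc_prob_out. Qed.

Let trunc_prob_smooth (I : Type) (U : I -> open_set X) : directed U ->
  trunc_prob P (\bigcup_i U i) = ereal_sup (range (fun i => trunc_prob P (U i))).
Proof.
move=> dU; rewrite trunc_probE.
  rewrite smooth//; congr ereal_sup; congr (_ @` _); apply/funext => i.
  by rewrite trunc_probE//; exact: open_borel (oset_open _).
by apply: open_borel; apply: bigcup_open => i _; exact: oset_open.
Qed.

Definition mk_tau_prob : tau_prob :=
  @TauProb h (trunc_prob P : probability _ R) out trunc_prob_smooth.

Lemma mk_tau_probE (A : set X) : is_borel A -> mk_tau_prob A = P A.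
Proof. by move=> bA; exact: trunc_probE. Qed.

End make.

Section iotaPV.
Context (p : tau_prob).

Let m (U : open_set X) : \bar R := p U.

Let mU (U : open_set X) : measurable (U : set (borel (tp_inh p))).
Proof. exact: open_borel (oset_open U). Qed.

Let m_ge0 U : 0 <= m U. Proof. exact: measure_ge0. Qed.

Let m_set0 : m (OpenSet open0) = 0. Proof. exact: measure0. Qed.

Let m_modular (U W : open_set X) :
  m (OpenSet (openU (oset_open U) (oset_open W))) +
  m (OpenSet (openI (oset_open U) (oset_open W))) = m U + m W.
Proof.
have fU (A : set X) : measurable (A : set (borel (tp_inh p))) ->
  p A \is a fin_num by exact: fin_num_measure.
rewrite /m/= measureUfinl//; last by rewrite -ge0_fin_numE ?fU//; exact: m_ge0.
by rewrite subeK// fU//; exact: (measurableI _ _ (mU U) (mU W)).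
Qed.

Let m_directed (I : Type) (U : I -> open_set X) : directed U ->
  m (bigcup_open_set U) = ereal_sup (range (m \o U)).
Proof. exact: tp_smooth. Qed.

Definition iotaPV : valuation R X := Valuation m_ge0 m_set0 m_modular m_directed.

End iotaPV.

End tau_prob.

Section integral.
Context (R : realType) (X : topologicalType).

Lemma lsc_measurable (h : $| X |) (g : X -> \bar R) : lsc_ge0 g ->
  measurable_fun setT (g : borel h -> \bar R).
Proof.
move=> lg; apply: (measurability _ (ErealGenOInfty.measurableE R)).
move=> /= _ [_ [a ->]] <-; rewrite setTI preimage_itvoy.
exact: open_borel (lsc_open a lg).
Qed.

Lemma tau_integralE (p : tau_prob R X) (g : X -> \bar R) : lsc_ge0 g ->
  tau_integral p g = vint (iotaPV p) g.
Proof.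
move=> lg.
have lev N k : lsc_ge0 (fun x => (\1_(sup_level g (2 ^- N) k) x)%:E : \bar R).
  by apply: lsc_indic; exact: lsc_open.
have ms N k : measurable (sup_level g (2 ^- N) k : set (borel (tp_inh p))).
  exact: open_borel (lsc_open _ lg).
pose s N x : \bar R := dy (valuation_unit R x) N g.
have sE N x : s N x = (2 ^- N)%:E * \sum_(k < 4 ^ N) (\1_(sup_level g (2 ^- N) k) x)%:E.
  rewrite /s /dy; congr (_ * _); apply: eq_bigr => k _.
  by rewrite (vext_open _ (lsc_open (k.+1%:R * 2 ^- N)%R lg)).
have gE x : g x = limn (s ^~ x).
  apply/esym/cvg_lim => //; rewrite -(vint_unit x lg) vintE//.
  exact/ereal_nondecreasing_cvgn/dy_nd.
have ls N : lsc_ge0 (s N).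
  rewrite /s; under eq_fun do rewrite -/(s _ _) sE.
  by apply: lsc_scale => //; apply: lsc_sum => k; exact: lev.
rewrite /tau_integral.
under eq_integral do rewrite gE.
rewrite monotone_convergence//; last 3 first.
- by move=> N; exact: lsc_measurable.
- by move=> N x _; case: (ls N).
- by move=> x _; exact: dy_nd.
rewrite vintE//; apply/cvg_lim => //.
rewrite (_ : (fun N => _) = dy (iotaPV p) ^~ g).
  exact/ereal_nondecreasing_cvgn/dy_nd.
apply/funext => N.
under eq_integral do rewrite sE.
rewrite ge0_integralZl//; last 2 first.
- apply: lsc_measurable; apply: lsc_sum => k; exact: lev.
- by move=> x _; apply: sume_ge0 => k _; rewrite lee_fin indicE.
rewrite ge0_integral_sum//; last first.
- by move=> k; exact: lsc_measurable.
rewrite /dy; congr (_ * _); apply: eq_bigr => k _.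
rewrite integral_indic// setIT.
by rewrite (vext_open _ (lsc_open (k.+1%:R * 2 ^- N)%R lg)).
Qed.

Lemma tau_integral_lsc (g : X -> \bar R) : lsc_ge0 g ->
  lsc_ge0 (fun p : tau_prob R X => tau_integral p g).
Proof.
move=> lg; apply: lscP => [p|r].
  by apply: integral_ge0 => x _; case: lg.
by apply: gen_topology_open; exists g => //; exists r.
Qed.

Lemma tau_ev_lsc (U : open_set X) : lsc_ge0 (fun p : tau_prob R X => p U).
Proof.
have lU : lsc_ge0 (fun x => (\1_U x)%:E : \bar R) by apply/lsc_indic/oset_open.
have := tau_integral_lsc lU.
by under eq_fun do rewrite tau_integralE// vint_indic.
Qed.

Lemma tau_prob_continuous (Y : topologicalType) (f : Y -> tau_prob R X) :
  (forall g, lsc_ge0 g -> lsc_ge0 (fun y => tau_integral (f y) g)) -> continuous f.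
Proof.
move=> fg; apply: (@gen_topology_continuous (tau_prob R X)) => _ [g lg [r ->]].
by have := lsc_open r (fg g lg).
Qed.

End integral.

Section tau_prob_mult.
Context (R : realType) (X : topologicalType).

Lemma tau_ev_measurable (h : $| tau_prob R X |) (A : set X) : is_borel A ->
  measurable_fun setT (fun p : borel h => (p : tau_prob R X) A).
Proof.
have h' : $| X | by case: h => p; exact: tp_inh p.
move: A; apply: (@dynkin_induction _ (borel h') (@open X)) => //.
- exact: openI.
- rewrite (_ : (fun _ => _) = cst 1); first exact: measurable_cst.
  by apply/funext => p; exact: probability_setT.
- move=> U oU; exact: (lsc_measurable (tau_ev_lsc R (OpenSet oU))).
- move=> S mS IH.
  rewrite (_ : (fun _ => _) = (fun p : borel h => 1 - (p : tau_prob R X) S)).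
    by apply: emeasurable_funB => //; exact: measurable_cst.
  by apply/funext => p; exact: (@probability_setC _ _ _ (tp_prob (p : tau_prob R X))).
- move=> F mF tF IH.
  rewrite (_ : (fun _ => _) =
      (fun p : borel h => \sum_(0 <= k <oo) (p : tau_prob R X) (F k))).
    exact: ge0_emeasurable_sum.
  apply/funext => p; apply: (@measure_semi_bigcup _ _ _ (tp_prob (p : tau_prob R X))) => //.
  exact: (@bigcupT_measurable _ (borel h')).
Qed.

End tau_prob_mult.

Lemma tau_prob_setT (R : realType) (X : topologicalType) (p : tau_prob R X) :
  p setT = 1.
Proof. exact: probability_setT. Qed.

Lemma tau_prob_ge0 (R : realType) (X : topologicalType) (p : tau_prob R X) A :
  0 <= p A.
Proof. exact: measure_ge0. Qed.

Section tau_map.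
Context (R : realType) (X Y : topologicalType) (f : continuousType X Y).

Lemma cts_borel (A : set Y) : is_borel A -> is_borel (f @^-1` A).
Proof.
suff : <<s @open Y >> `<=` [set A | is_borel (f @^-1` A)] by apply.
apply: smallest_sub.
  split => [|B|F].
  - by rewrite /= preimage_set0; exact: sigma_algebra0.
  - by rewrite setTD /= preimage_setC -setTD; exact: sigma_algebraCD.
  - by move=> bF; rewrite /= preimage_bigcup; exact: sigma_algebra_bigcup.
by move=> U oU; exact: open_borel (cts_open f oU).
Qed.

Section map.
Context (p : tau_prob R X).

Let inh : $| Y | := squash (f (unsquash (tp_inh p))).

Let m : set (borel inh) -> \bar R :=
  @pushforward _ _ (borel (tp_inh p)) (borel inh) R (tp_prob p) f.

Let m0 : m set0 = 0.
Proof. by rewrite /m /pushforward preimage_set0 measure0. Qed.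

Let m_ge0 A : 0 <= m A. Proof. exact: tau_prob_ge0. Qed.

Let m_sigma_additive : semi_sigma_additive m.
Proof.
move=> F mF tF mUF; rewrite /m /pushforward preimage_bigcup.
apply: measure_semi_sigma_additive.
- by move=> n; exact: cts_borel (mF n).
- apply/trivIsetP => i j _ _ ij; rewrite -preimage_setI; move/trivIsetP : tF => ->//; exact: preimage_set0.
- by rewrite -preimage_bigcup; exact: cts_borel mUF.
Qed.

HB.instance Definition _ := isMeasure.Build _ _ _ m m0 m_ge0 m_sigma_additive.

Let m_setT : m setT = 1.
Proof. exact: tau_prob_setT. Qed.

HB.instance Definition _ := Measure_isProbability.Build _ _ _ m m_setT.

Let m_smooth (I : Type) (U : I -> open_set Y) : directed U ->
  m (\bigcup_i U i) = ereal_sup (range (fun i => m (U i))).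
Proof. by move=> dU; exact: (v_directed (valuation_map f (iotaPV p)) dU). Qed.

Definition tau_map : tau_prob R Y := @mk_tau_prob R Y inh (m : probability _ R) m_smooth.

Lemma tau_mapE (A : set Y) : is_borel A -> tau_map A = p (f @^-1` A).
Proof. by move=> bA; rewrite /tau_map mk_tau_probE. Qed.

End map.

Lemma iotaPV_map (p : tau_prob R X) : iotaPV (tau_map p) = valuation_map f (iotaPV p).
Proof.
by apply: valuation_eq => U; exact: tau_mapE (open_borel (oset_open U)).
Qed.

Lemma tau_integral_map (p : tau_prob R X) (g : Y -> \bar R) : lsc_ge0 g ->
  tau_integral (tau_map p) g = tau_integral p (g \o f).
Proof.
by move=> lg; rewrite !tau_integralE ?iotaPV_map ?vint_map//; exact: lsc_comp.
Qed.

Lemma tau_map_continuous : continuous tau_map.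
Proof.
apply: tau_prob_continuous => g lg.
under eq_fun do rewrite tau_integral_map//.
exact/tau_integral_lsc/lsc_comp.
Qed.

HB.instance Definition _ := isContinuous.Build _ _ tau_map tau_map_continuous.

End tau_map.

Section tau_unit.
Context (R : realType) (X : topologicalType).

Section unit.
Context (x : X).

Let m : set (borel (squash x)) -> \bar R := @dirac _ (borel (squash x)) x R.

Let m_smooth (I : Type) (U : I -> open_set X) : directed U ->
  m (\bigcup_i U i) = ereal_sup (range (fun i => m (U i))).
Proof. by move=> dU; exact: (v_directed (valuation_unit R x) dU). Qed.

Definition tau_unit : tau_prob R X :=
  @mk_tau_prob R X (squash x) (@dirac _ (borel (squash x)) x R : probability _ R) m_smooth.

Lemma tau_unitE (A : set X) : is_borel A -> tau_unit A = (\1_A x)%:E.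
Proof. by move=> bA; rewrite /tau_unit mk_tau_probE. Qed.

End unit.

Lemma iotaPV_unit x : iotaPV (tau_unit x) = valuation_unit R x.
Proof.
by apply: valuation_eq => U; exact: tau_unitE (open_borel (oset_open U)).
Qed.

Lemma tau_unit_continuous : continuous tau_unit.
Proof.
apply: tau_prob_continuous => g lg.
by under eq_fun do rewrite tau_integralE// iotaPV_unit vint_unit//.
Qed.

HB.instance Definition _ := isContinuous.Build _ _ tau_unit tau_unit_continuous.

End tau_unit.

Lemma iotaPV_continuous (R : realType) (X : topologicalType) :
  continuous (@iotaPV R X).
Proof.
apply: valuation_continuous => g lg.
by under eq_fun do rewrite -tau_integralE//; exact: tau_integral_lsc.
Qed.

HB.instance Definition _ (R : realType) (X : topologicalType) :=
  isContinuous.Build _ _ (@iotaPV R X) (@iotaPV_continuous R X).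

Section tau_mult.
Context (R : realType) (X : topologicalType).

Section mult.
Context (mu : tau_prob R (tau_prob R X)).

Let inh : $| X | := tp_inh (unsquash (tp_inh mu)).

Let m (A : set (borel inh)) : \bar R := \int[tp_prob mu]_p (p : tau_prob R X) A.

Let m0 : m set0 = 0.
Proof. by rewrite /m integral0_eq// => p _; exact: measure0. Qed.

Let m_ge0 A : 0 <= m A.
Proof. by apply: integral_ge0 => p _; exact: tau_prob_ge0. Qed.

Let m_sigma_additive : semi_sigma_additive m.
Proof.
move=> F mF tF mUF.
have mev i : measurable_fun setT
    (fun p : borel (tp_inh mu) => (p : tau_prob R X) (F i)).
  exact: (tau_ev_measurable (mF i)).
have -> : m (\bigcup_n F n) =
    \int[tp_prob mu]_p (\sum_(0 <= k <oo) (p : tau_prob R X) (F k)).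
  apply: eq_integral => p _.
  exact: (@measure_semi_bigcup _ _ _ (tp_prob (p : tau_prob R X))).
rewrite (_ : (fun n => _) = (fun n =>
    \int[tp_prob mu]_p (\sum_(0 <= i < n) (p : tau_prob R X) (F i)))).
  apply: cvg_monotone_convergence => //.
  - by move=> n; exact: emeasurable_sum.
  - by move=> n p _; apply: sume_ge0 => i _; exact: tau_prob_ge0.
  - move=> p _ i j ij; apply: ereal_nondecreasing_series => // k _ _; exact: (tau_prob_ge0 (p : tau_prob R X)).
apply/funext => n; by rewrite ge0_integral_sum//.
Qed.

HB.instance Definition _ := isMeasure.Build _ _ _ m m0 m_ge0 m_sigma_additive.

Let m_setT : m setT = 1.
Proof.
rewrite /m; under eq_integral do rewrite tau_prob_setT.
by rewrite integral_cst// mul1e; exact: tau_prob_setT.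
Qed.

HB.instance Definition _ := Measure_isProbability.Build _ _ _ m m_setT.

Let mE (U : open_set X) : m U = vint (iotaPV mu) (fun p => p U).
Proof. by rewrite -tau_integralE//; exact: tau_ev_lsc. Qed.

Let mV (U : open_set X) : m U =
  valuation_mult (valuation_map (@iotaPV R X) (iotaPV mu)) U.
Proof. by rewrite mE /= vint_map//; exact: ev_lsc. Qed.

Let m_smooth (I : Type) (U : I -> open_set X) : directed U ->
  m (\bigcup_i U i) = ereal_sup (range (fun i => m (U i))).
Proof.
move=> dU; rewrite (mV (bigcup_open_set U)) v_directed//.
by congr ereal_sup; congr (_ @` _); apply/funext => i; exact: (esym (mV (U i))).
Qed.

Definition tau_mult : tau_prob R X :=
  @mk_tau_prob R X inh (m : probability _ R) m_smooth.

Lemma tau_multE (A : set X) : is_borel A ->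
  tau_mult A = \int[tp_prob mu]_p (p : tau_prob R X) A.
Proof. by move=> bA; rewrite /tau_mult mk_tau_probE. Qed.

Lemma iotaPV_mult : iotaPV tau_mult = valuation_mult (valuation_map (@iotaPV R X) (iotaPV mu)).
Proof.
apply: valuation_eq => U; apply: etrans (mV U).
exact: tau_multE (open_borel (oset_open U)).
Qed.

End mult.

Lemma tau_integral_mult mu (g : X -> \bar R) : lsc_ge0 g ->
  tau_integral (tau_mult mu) g = tau_integral mu (fun p => tau_integral p g).
Proof.
move=> lg; rewrite [LHS]tau_integralE// iotaPV_mult vint_mult// vint_map//; last exact: vint_lsc.
rewrite tau_integralE; last exact: tau_integral_lsc.
by congr vint; apply/funext => p; rewrite /= tau_integralE.
Qed.

Lemma tau_mult_continuous : continuous tau_mult.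
Proof.
apply: tau_prob_continuous => g lg.
under eq_fun do rewrite tau_integral_mult//.
exact/tau_integral_lsc/tau_integral_lsc.
Qed.

HB.instance Definition _ := isContinuous.Build _ _ tau_mult tau_mult_continuous.

End tau_mult.

(* tau-smooth measures agreeing on the open sets agree on the Borel sets *)
Lemma iotaPV_inj (R : realType) (X : topologicalType) : injective (@iotaPV R X).
Proof.
move=> p q pq; apply: tau_prob_eq.
have bE h (A : set X) : is_borel A -> measurable (A : set (@borel X h)) by [].
apply: (@dynkin_induction _ (borel (tp_inh p)) (@open X)) => //.
- exact: openI.
- by rewrite !tau_prob_setT.
- by move=> U oU; exact: (congr1 (fun nu : valuation R X => nu (OpenSet oU)) pq).
- move=> S mS pS.
  have := @probability_setC _ _ _ (tp_prob p) S mS.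
  have := @probability_setC _ _ _ (tp_prob q) S mS.
  by move=> -> ->; rewrite pS.
- move=> F mF tF pF.
  have mUF : is_borel (\bigcup_k F k).
    exact: (@bigcupT_measurable _ (borel (tp_inh p))).
  rewrite (@measure_semi_bigcup _ _ _ (tp_prob p))//.
  rewrite (@measure_semi_bigcup _ _ _ (tp_prob q))//.
  by apply: eq_eseriesr => i _; exact: pF.
Qed.

Section tau_monad.
Context (R : realType).

Definition monadP : monad.
Proof.
apply: (@Monad (fun X => tau_prob R X) (fun X Y f => @tau_map R X Y f)
  (fun X => @tau_unit R X) (fun X => @tau_mult R X)).
- by move=> X p; apply: iotaPV_inj; rewrite iotaPV_map; exact: (@mmap_id (monadV R)).
- move=> X Y Z f g p; apply: iotaPV_inj; rewrite !iotaPV_map.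
  exact: (@mmap_comp (monadV R)).
- move=> X Y f x; apply: iotaPV_inj; rewrite iotaPV_map !iotaPV_unit.
  exact: (@munit_nat (monadV R)).
- move=> X Y f mu; apply: iotaPV_inj; rewrite iotaPV_map !iotaPV_mult iotaPV_map.
  rewrite [LHS](@mmult_nat (monadV R)); congr valuation_mult.
  rewrite -[LHS](@mmap_comp (monadV R)) -[RHS](@mmap_comp (monadV R)).
  rewrite /=; congr (valuation_map _ _); apply/continuousEP => p.
  by rewrite /= iotaPV_map.
- move=> X p; apply: iotaPV_inj; rewrite iotaPV_mult iotaPV_unit.
  rewrite [X in valuation_mult X](@munit_nat (monadV R)).
  exact: (@mmult_unit (monadV R)).
- move=> X p; apply: iotaPV_inj; rewrite iotaPV_mult iotaPV_map.
  rewrite -[X in valuation_mult X](@mmap_comp (monadV R)) -[RHS](@mmult_map_unit (monadV R)).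
  congr (valuation_mult (valuation_map _ _)); apply/continuousEP => x.
  by rewrite /= iotaPV_unit.
- move=> X p; apply: iotaPV_inj; rewrite !iotaPV_mult iotaPV_map.
  rewrite [X in valuation_mult X](@mmult_nat (monadV R)).
  rewrite [LHS](@mmult_assoc (monadV R)).
  congr valuation_mult.
  rewrite -!(@mmap_comp (monadV R)).
  congr (valuation_map _ _); apply/continuousEP => q.
  by rewrite /= iotaPV_mult.
Defined.

End tau_monad.

(* Main.v *)
Require Import Defs.
From HB Require Import structures.
From mathcomp Require Import all_boot all_order all_algebra.
From mathcomp Require Import all_classical all_reals all_analysis.

(** Algebras are contravariant in the monad: if [phi : S -> T] is a morphism of
    monads, then precomposing the structure map of a [T]-algebra with [phi A]
    gives an [S]-algebra ([is_algebra_pullback]). The corollary is this fact for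
    the two morphisms [iotaPV : P -> V] and [supp : V -> H].

    The content is thus that the support is a morphism of monads. A closed set
    is determined by the open sets that it hits, and [supp nu] hits [U] exactly
    when [nu U > 0]; each condition on [supp] is therefore a statement about
    which open sets have positive mass. For naturality and the unit it is
    immediate. For the multiplication, the mass of [U] under the average of [xi]
    is the integral of [rho |-> rho U] against [xi], and it has to be positive
    exactly when the open set [[set rho | rho U > 0]] is not [xi]-null. This is
    the general principle [hit_supp_vint]: an integral is positive if and only if
    the support meets the set where the integrand is positive. Continuity of
    [supp] holds because [nu |-> nu U] is lower semicontinuous. *)

Set Implicit Arguments.
Unset Strict Implicit.
Unset Printing Implicit Defensive.

Import Order.TTheory GRing.Theory Num.Theory.

Local Open Scope classical_set_scope.
Local Open Scope ereal_scope.

Record monad_morphism (S T : monad)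
    (phi : forall X : topologicalType, continuousType (S X) (T X)) : Prop :=
  MonadMorphism {
    morphism_nat : forall (X Y : topologicalType) (f : continuousType X Y) t,
      phi Y (mmap S f t) = mmap T f (phi X t);
    morphism_unit : forall (X : topologicalType) (x : X),
      phi X (munit S X x) = munit T X x;
    morphism_mult : forall (X : topologicalType) t,
      phi X (mmult S X t) = mmult T X (mmap T (phi X) (phi (S X) t)) }.

(** With [b := a \o phi A], naturality turns [phi A (S b t)] into
    [T b (phi t) = T a (T phi (phi t))], to which the associativity of [a]
    applies; the multiplication square of [phi] brings the result back to [S]. *)
Lemma is_algebra_pullback (S T : monad)
    (phi : forall X : topologicalType, continuousType (S X) (T X))
    (A : topologicalType) (a : T A -> A) :
  monad_morphism phi -> is_algebra T a -> is_algebra S (a \o phi A).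
Proof.
move=> [phi_nat phi_unit phi_mult] [ca [a_unit a_assoc]].
have cb : continuous (a \o phi A).
  by move=> t; apply: continuous_comp; [exact: cts_fun|exact: ca].
exists cb; split => [x|t] /=; first by rewrite phi_unit a_unit.
rewrite phi_nat phi_mult -a_assoc -mmap_comp.
by congr (a (mmap T _ _)); apply/continuousEP.
Qed.

Section support.
Context (R : realType) (X : topologicalType).

Lemma hit_subset (U W : set X) (C : closed_set X) :
  U `<=` W -> hit U C -> hit W C.
Proof. by move=> UW [x [Cx Ux]]; exists x; split => //; exact: UW. Qed.

Lemma hit_supp (nu : valuation R X) (U : set X) (oU : open U) :
  hit U (supp nu) <-> 0 < nu (OpenSet oU).
Proof. exact: (suppP nu (OpenSet oU)). Qed.

(** A positive integral is witnessed by a simple function below [g], one of whose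
    steps has positive mass and lies in the set where [g > 0]. Conversely, at a
    point of the support with [g x > 0], the set [[set y | r < g y]] is an open
    neighbourhood of [x] for any real [r] with [0 < r < g x]; it has positive mass
    and [r] times its indicator is below [g]. *)
Lemma hit_supp_vint (nu : valuation R X) (g : X -> \bar R) : lsc_ge0 g ->
  hit [set x | 0 < g x] (supp nu) <-> 0 < vint nu g.
Proof.
move=> lg; have [g0 _] := lg; split=> [[x [xsupp /= gx]]|].
  have [r r0 rg] : exists2 r : R, (0 < r)%R & r%:E < g x.
    case: (g x) gx => [u||] // => [u0|_]; last by exists 1%R; rewrite ?ltry.
    by exists ((0 + u) / 2)%R; rewrite ?lte_fin midf_lt.
  apply: (@lt_le_trans _ _ (r%:E * nu (OpenSet (lsc_open r lg)))).
    by apply: mule_gt0; [rewrite lte_fin|exact: xsupp].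
  apply: ereal_sup_ubound.
  exists 1%N, (fun=> r%:E), (fun=> OpenSet (lsc_open r lg)); split.
  - by move=> _; rewrite lte_fin.
  - move=> y; rewrite big_ord1 indicE.
    have [/set_mem/= ry|_] := boolP (y \in _); last by rewrite mule0.
    by rewrite mule1 ltW.
  - by rewrite big_ord1.
move=> /ereal_sup_gt[_ [n [r [U [r0 rU ->]]]] sum_gt0].
have [i nuUi] : exists i, 0 < nu (U i).
  apply: contrapT => nuU; move: sum_gt0; rewrite big1 ?ltxx// => i _.
  suff -> : nu (U i) = 0 by rewrite mule0.
  apply/eqP; rewrite eq_le v_ge0 andbT leNgt; apply/negP => nuUi.
  by apply: nuU; exists i.
apply: (@hit_subset (U i)); last exact/suppP.
move=> x Uix /=; apply: lt_le_trans (rU x).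
rewrite (bigD1 i)//= indicE mem_set// mule1.
apply: (lt_le_trans (r0 i)); rewrite leeDl// sume_ge0// => j _.
by rewrite mule_ge0 ?lee_fin ?indicE// ltW.
Qed.

Lemma supp_continuous : continuous (@supp R X).
Proof.
apply: hit_continuous => U oU.
rewrite (_ : _ @^-1` _ = [set nu : valuation R X | 0 < nu (OpenSet oU)]).
  exact: (lsc_open 0%R (ev_lsc R (OpenSet oU))).
by apply/seteqP; split => nu /(hit_supp nu oU).
Qed.

HB.instance Definition _ := isContinuous.Build _ _ (@supp R X) supp_continuous.

End support.

Lemma supp_morphism (R : realType) :
  @monad_morphism (monadV R) monadH (fun X => @supp R X).
Proof.
split=> [X Y f nu|X x|X xi]; apply: hit_ext => U oU; rewrite (hit_supp _ oU).
- rewrite hit_map//; exact: iff_sym (hit_supp nu (cts_open f oU)).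
- rewrite hit_unit//= lte_fin indicE.
  by split=> [|/mem_set ->//]; case: (boolP (x \in U)) => [/set_mem|_]; rewrite ?ltxx.
- rewrite hit_mult// hit_map; last exact: hit_open.
  apply: (iff_trans (iff_sym (hit_supp_vint xi (ev_lsc R (OpenSet oU))))).
  by split; apply: hit_subset => rho /(hit_supp rho oU).
Qed.

Lemma iotaPV_morphism (R : realType) :
  @monad_morphism (monadP R) (monadV R) (fun X => @iotaPV R X).
Proof.
by split=> [X Y f p|X x|X mu]; [exact: iotaPV_map|exact: iotaPV_unit|exact: iotaPV_mult].
Qed.

Theorem corollary5p14 (R : realType) (A : topologicalType)
    (a : monadH A -> A) (ha : is_algebra monadH a) :
  is_algebra (monadV R) (a \o @supp R A) /\
  is_algebra (monadP R) (a \o @supp R A \o @iotaPV R A).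
Proof.
have algV : is_algebra (monadV R) (a \o @supp R A).
  exact: is_algebra_pullback (supp_morphism R) ha.
by split=> //; exact: is_algebra_pullback (iotaPV_morphism R) algV.
Qed.
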